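(* Let $n\ge2$ and let $\Phi\colon M_n(\mathbb C)\to M_n(\mathbb C)$ be a BJ isomorphism. Then there exists a function $\gamma\colon M_n(\mathbb C)\to\mathbb C\setminus\{0\}$ such that the map $X\mapsto\gamma(X)\Phi(X)$ is a linear or conjugate-linear isometry of $M_n(\mathbb C)$.
   Context: $M_n(\mathbb C)$ carries the operator (spectral) norm. For $A,B$ in a complex normed space, $A\perp B$ (Birkhoff–James orthogonality) means $\|A+\lambda B\|\ge\|A\|$ for all $\lambda\in\mathbb C$. A BJ isomorphism is a bijective map $\Phi$ such that $A\perp B$ if and only if $\Phi(A)\perp\Phi(B)$. *)

(* Defs.v *)
(* complex numbers are R[i] (mathcomp-real-closed) over an
   abstract R : realType (MathComp-Analysis), so that the operator norm can be
   defined as a supremum. *)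
From HB Require Import structures.
From mathcomp Require Import all_boot all_order all_algebra.
From mathcomp Require Import complex.
From mathcomp Require Import classical_sets reals.
Set Implicit Arguments. Unset Strict Implicit. Unset Printing Implicit Defensive.
Import Order.TTheory GRing.Theory Num.Theory.
Local Open Scope ring_scope.
Local Open Scope classical_set_scope.

Definition vnorm (R : realType) (n : nat) (x : 'cV[R[i]]_n) : R :=
  Num.sqrt (\sum_(k < n) (Normc.normc (x k 0)) ^+ 2).

Definition opnorm (R : realType) (n : nat) (A : 'M[R[i]]_n) : R :=
  sup [set vnorm (A *m x) | x in [set x : 'cV[R[i]]_n | vnorm x <= 1]].

Definition BJorth (R : realType) (n : nat) (A B : 'M[R[i]]_n) : Prop :=
  forall l : R[i], opnorm A <= opnorm (A + l *: B).

Definition BJiso (R : realType) (n : nat) (Phi : 'M[R[i]]_n -> 'M[R[i]]_n) : Prop :=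
  bijective Phi /\ forall A B, BJorth A B <-> BJorth (Phi A) (Phi B).

Definition is_linear (R : realType) (n : nat) (Psi : 'M[R[i]]_n -> 'M[R[i]]_n) : Prop :=
  forall (a : R[i]) X Y, Psi (a *: X + Y) = a *: Psi X + Psi Y.

Definition is_conjlinear (R : realType) (n : nat) (Psi : 'M[R[i]]_n -> 'M[R[i]]_n) : Prop :=
  forall (a : R[i]) X Y, Psi (a *: X + Y) = conjc a *: Psi X + Psi Y.

Definition is_isometry (R : realType) (n : nat) (Psi : 'M[R[i]]_n -> 'M[R[i]]_n) : Prop :=
  forall X Y, opnorm (Psi X - Psi Y) = opnorm (X - Y).

(* Main.v *)
(** Birkhoff-James orthogonality to a rank-one matrix [y x'] (with [x'] the
    conjugate transpose of [x]) is one linear condition, [<y, B x> = 0], and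
    every [B] to which [y x'] is orthogonal is one to which [A] is orthogonal iff
    [A] attains its norm at [x] and [y] is proportional to [A x].  Both facts
    need only the elementary parts of the Bhatia-Semrl theorem, without the
    convexity of the numerical range.
    A nonzero [B] has rank one iff every non-smooth [A] is orthogonal to it,
    because the space where such an [A] attains its norm has dimension at least
    two and thus meets [ker B].  Hence [Phi] maps rank-one matrices to rank-one
    matrices; it also preserves the relation "proportional row or column
    vectors", and, up to composing with the conjugate transpose,
    [Phi (y x')] is proportional to [(g y) (f x)'].

    As [1] attains its norm everywhere, so does [W = Phi 1], which is thus a
    multiple of a unitary matrix, with [g x] proportional to [W (f x)].  After
    composing with [W'] and with a suitable multiple of a unitary matrix, [f]
    becomes a map [h] on rays that fixes the coordinate axes and the ray of
    [(1, ..., 1)], preserves orthogonality, and satisfies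
    [<y, B x> = 0 <-> <h y, Q B (h x)> = 0] for all [B].  Thus [h] intertwines
    [B] with [Q B].  Applied to diagonal matrices and shears this shows that [h]
    acts coordinatewise by a field endomorphism of the complex numbers, which
    commutes with conjugation because [h] preserves orthogonality; so it is the
    identity or the conjugation. *)

Require Import Defs.
From HB Require Import structures.
From mathcomp Require Import all_boot all_order all_algebra.
From mathcomp Require Import perm complex ring lra.
From mathcomp Require Import boolp classical_sets reals.
From mathcomp Require Import topology normedtype derive.
Set Implicit Arguments. Unset Strict Implicit. Unset Printing Implicit Defensive.
Import Order.TTheory GRing.Theory Num.Theory.
Import numFieldNormedType.Exports.
Local Open Scope ring_scope.
Local Notation Re := (@complex.Re _).
Local Notation Im := (@complex.Im _).

(** * Conjugate transposes, inner products and squared norms *)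

Section Inner.
Variable R : realType.
Local Notation C := R[i].

Definition ctr m n (A : 'M[C]_(m, n)) : 'M[C]_(n, m) := map_mx conjc A^T.
Definition ip n (x y : 'cV[C]_n) : C := (ctr x *m y) 0 0.
(** Squared norms with values in [R] replace norms in the estimates, which keeps most square roots
    away. *)
Definition sq n (x : 'cV[C]_n) : R := Re (ip x x).
Definition rk1 n (y x : 'cV[C]_n) : 'M[C]_n := y *m ctr x.

Lemma ctrM m n p (A : 'M[C]_(m, n)) (B : 'M[C]_(n, p)) : ctr (A *m B) = ctr B *m ctr A.
Proof. by rewrite /ctr trmx_mul map_mxM. Qed.

Lemma ctrK m n (A : 'M[C]_(m, n)) : ctr (ctr A) = A.
Proof. by apply/matrixP => i j; rewrite !mxE conjcK. Qed.

Lemma ctrD m n (A B : 'M[C]_(m, n)) : ctr (A + B) = ctr A + ctr B.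
Proof. by rewrite /ctr linearD map_mxD. Qed.

Lemma ctrZ m n a (A : 'M[C]_(m, n)) : ctr (a *: A) = conjc a *: ctr A.
Proof. by rewrite /ctr linearZ map_mxZ. Qed.

Lemma ctr0 m n : ctr (0 : 'M[C]_(m, n)) = 0.
Proof. by rewrite /ctr trmx0 map_mx0. Qed.

Section Vec.
Variable n : nat.
Implicit Types x y z : 'cV[C]_n.

Lemma ipE x y : ip x y = \sum_k conjc (x k 0) * y k 0.
Proof. by rewrite /ip mxE; apply: eq_bigr => k _; rewrite !mxE. Qed.

Lemma ipDr x y z : ip x (y + z) = ip x y + ip x z.
Proof. by rewrite /ip mulmxDr mxE. Qed.
Lemma ipZr a x y : ip x (a *: y) = a * ip x y.
Proof. by rewrite /ip -scalemxAr mxE. Qed.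
Lemma ipDl x y z : ip (y + z) x = ip y x + ip z x.
Proof. by rewrite /ip ctrD mulmxDl mxE. Qed.
Lemma ipZl a x y : ip (a *: x) y = conjc a * ip x y.
Proof. by rewrite /ip ctrZ -scalemxAl mxE. Qed.
Lemma ipNr x y : ip x (- y) = - ip x y.
Proof. by rewrite -scaleN1r ipZr mulN1r. Qed.
Lemma ipNl x y : ip (- x) y = - ip x y.
Proof. by rewrite -scaleN1r ipZl rmorphN1 mulN1r. Qed.
Lemma ipBr x y z : ip x (y - z) = ip x y - ip x z.
Proof. by rewrite ipDr ipNr. Qed.
Lemma ip0r x : ip x 0 = 0.
Proof. by rewrite /ip mulmx0 mxE. Qed.
Lemma ip0l x : ip 0 x = 0.
Proof. by rewrite /ip ctr0 mul0mx mxE. Qed.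
Lemma ipC x y : ip y x = conjc (ip x y).
Proof.
rewrite !ipE rmorph_sum; apply: eq_bigr => k _.
by rewrite rmorphM /= conjcK mulrC.
Qed.
Lemma ip_eq0C x y : (ip x y = 0) <-> (ip y x = 0).
Proof. by rewrite (ipC x y); split=> [->|/eqP]; rewrite ?conjc0 // conjc_eq0 => /eqP. Qed.

Lemma sqE x : sq x = \sum_k (Re (x k 0) ^+ 2 + Im (x k 0) ^+ 2).
Proof.
rewrite /sq ipE raddf_sum; apply: eq_bigr => k _.
by case: (x k 0) => a b /=; rewrite !expr2; ring.
Qed.

Lemma ip_sq x : ip x x = (sq x)%:C%C.
Proof.
rewrite /sq; have : Im (ip x x) = 0.
  by have := ipC x x; case: (ip x x) => a b /= [] ? ; lra.
by case: (ip x x) => a b /= ->.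
Qed.

Lemma sq_ge0 x : 0 <= sq x.
Proof. by rewrite sqE sumr_ge0 // => k _; rewrite addr_ge0 // sqr_ge0. Qed.

Lemma sq_eq0 x : (sq x == 0) = (x == 0).
Proof.
apply/eqP/eqP => [|->]; last by rewrite /sq ip0r.
rewrite sqE => /psumr_eq0P h; apply/matrixP => i j; rewrite ord1 mxE.
have {h} : Re (x i 0) ^+ 2 + Im (x i 0) ^+ 2 = 0.
  by apply: h => // k _; rewrite addr_ge0 // sqr_ge0.
move/eqP; rewrite paddr_eq0 ?sqr_ge0 // !sqrf_eq0 => /andP[/eqP a /eqP b].
by case: (x i 0) a b => ? ? /= -> ->.
Qed.

Lemma sq_gt0 x : (0 < sq x) = (x != 0).
Proof. by rewrite lt_def sq_ge0 andbT sq_eq0. Qed.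

Lemma ip_eq0 x : (ip x x == 0) = (x == 0).
Proof. by rewrite ip_sq -sq_eq0 (inj_eq (@complexI R)). Qed.

Definition nsq (a : C) : R := Re a ^+ 2 + Im a ^+ 2.

Lemma nsqE a : (nsq a)%:C%C = conjc a * a.
Proof. by case: a => a b; rewrite /nsq /=; congr (_ +i* _)%C; ring. Qed.

Lemma nsq_ge0 a : 0 <= nsq a. Proof. by rewrite addr_ge0 // sqr_ge0. Qed.

Lemma nsq_eq0 a : (nsq a == 0) = (a == 0).
Proof.
rewrite paddr_eq0 ?sqr_ge0 // !sqrf_eq0; case: a => a b /=.
by rewrite eq_complex.
Qed.

Lemma nsq_gt0 a : (0 < nsq a) = (a != 0).
Proof. by rewrite lt_def nsq_ge0 andbT nsq_eq0. Qed.

Lemma sqZ a x : sq (a *: x) = nsq a * sq x.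
Proof.
apply: (@complexI R); rewrite -ip_sq ipZl ipZr ip_sq mulrA -nsqE.
by rewrite -rmorphM.
Qed.

Lemma sqD x y : sq (x + y) = sq x + sq y + 2 * Re (ip x y).
Proof.
rewrite /sq !(ipDl, ipDr) (ipC x y); move: (ip x x) (ip y y) (ip x y).
by move=> [? ?] [? ?] [? ?] /=; ring.
Qed.

Lemma vnorm_sq x : vnorm x = Num.sqrt (sq x).
Proof.
rewrite /vnorm sqE; congr Num.sqrt; apply: eq_bigr => k _.
by case: (x k 0) => a b /=; rewrite sqr_sqrtr // addr_ge0 // sqr_ge0.
Qed.

Lemma rk1_mul y x z : rk1 y x *m z = ip x z *: y.
Proof.
by rewrite /rk1 -mulmxA [ctr x *m z]mx11_scalar mul_mx_scalar.
Qed.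

Lemma ctr_rk1 y x : ctr (rk1 y x) = rk1 x y.
Proof. by rewrite /rk1 ctrM ctrK. Qed.

Lemma rk1Zl a y x : rk1 (a *: y) x = a *: rk1 y x.
Proof. by rewrite /rk1 scalemxAl. Qed.
Lemma rk1Zr a y x : rk1 y (a *: x) = conjc a *: rk1 y x.
Proof. by rewrite /rk1 ctrZ -scalemxAr. Qed.

End Vec.

Lemma ip_ctr m n (A : 'M[C]_(m, n)) x y : ip (A *m x) y = ip x (ctr A *m y).
Proof. by rewrite /ip ctrM -mulmxA. Qed.

Lemma ip_ctrr m n (A : 'M[C]_(m, n)) x y : ip (ctr A *m x) y = ip x (A *m y).
Proof. by rewrite ip_ctr ctrK. Qed.

Lemma mulmx_ext m n (A B : 'M[C]_(m, n)) :
  (forall x : 'cV_n, A *m x = B *m x) -> A = B.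
Proof.
move=> h; apply/matrixP => i j.
by have := congr1 (fun v : 'cV_m => v i 0) (h (delta_mx j 0)); rewrite -!colE !mxE.
Qed.

Lemma ip_ext n (x y : 'cV[C]_n) : (forall z, ip z x = ip z y) -> x = y.
Proof.
move=> h; apply/eqP; rewrite -subr_eq0 -ip_eq0.
by rewrite ipBr h subrr.
Qed.

End Inner.

(** * Compactness of the unit sphere *)

Section Sphere.
Variable R : realType.
Local Notation C := R[i].

Section RealContinuity.
Variables (T : topologicalType) (f g : T -> R).
Hypotheses (cf : continuous f) (cg : continuous g).

Lemma continuous_addr : continuous (fun v => f v + g v).
Proof. by move=> v; apply: cvgD; [exact: cf|exact: cg]. Qed.

Lemma continuous_mulr : continuous (fun v => f v * g v).
Proof. by move=> v; apply: cvgM; [exact: cf|exact: cg]. Qed.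

Lemma continuous_subr : continuous (fun v => f v - g v).
Proof. by move=> v; apply: cvgB; [exact: cf|exact: cg]. Qed.

Lemma continuous_maxr : continuous (fun v => Num.max (f v) (g v)).
Proof. move=> v; exact: (@continuous_max R T f g v (@cf v) (@cg v)). Qed.

End RealContinuity.

Lemma continuous_bigsum (T : topologicalType) (I : Type) (r : seq I) (f : I -> T -> R) :
  (forall i, continuous (f i)) -> continuous (fun v => \sum_(i <- r) f i v).
Proof.
move=> cf; elim: r => [|i r IH].
  by under eq_fun do rewrite big_nil; exact: cst_continuous.
under eq_fun do rewrite big_cons.
by apply: continuous_addr; [exact: cf|exact: IH].
Qed.

Section Dim.
Variable n : nat.

(** Transports continuity and compactness from real row vectors of length [n + n] to complex column
    vectors. *)
Definition emb (v : 'rV[R]_(n + n)) : 'cV[C]_n :=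
  \col_k (v 0 (lshift n k) +i* v 0 (rshift n k))%C.

Lemma emb_surj x : exists v, emb v = x.
Proof.
exists (row_mx (\row_k Re (x k 0)) (\row_k Im (x k 0))).
apply/matrixP => i j; rewrite ord1 mxE.
by rewrite row_mxEl row_mxEr !mxE; case: (x i 0).
Qed.

Lemma continuous_Re_mul_emb m (A : 'M[C]_(m, n)) k :
  continuous (fun v => Re ((A *m emb v) k 0)).
Proof.
have -> : (fun v => Re ((A *m emb v) k 0)) = (fun v => \sum_j
   (Re (A k j) * v 0 (lshift n j) - Im (A k j) * v 0 (rshift n j))).
  apply/funext => v; rewrite mxE raddf_sum; apply: eq_bigr => j _.
  by rewrite mxE; case: (A k j).
apply: continuous_bigsum => j; apply: continuous_subr; apply: continuous_mulr;
  by [exact: cst_continuous|exact: coord_continuous].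
Qed.

Lemma continuous_Im_mul_emb m (A : 'M[C]_(m, n)) k :
  continuous (fun v => Im ((A *m emb v) k 0)).
Proof.
have -> : (fun v => Im ((A *m emb v) k 0)) = (fun v => \sum_j
   (Im (A k j) * v 0 (lshift n j) + Re (A k j) * v 0 (rshift n j))).
  apply/funext => v; rewrite mxE raddf_sum; apply: eq_bigr => j _.
  by rewrite mxE; case: (A k j) => a b /=; rewrite addrC.
apply: continuous_bigsum => j; apply: continuous_addr; apply: continuous_mulr;
  by [exact: cst_continuous|exact: coord_continuous].
Qed.

Lemma continuous_Re_ip_emb m (A B : 'M[C]_(m, n)) :
  continuous (fun v => Re (ip (A *m emb v) (B *m emb v))).
Proof.
have -> : (fun v => Re (ip (A *m emb v) (B *m emb v))) = (fun v => \sum_k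
   (Re ((A *m emb v) k 0) * Re ((B *m emb v) k 0) +
    Im ((A *m emb v) k 0) * Im ((B *m emb v) k 0))).
  apply/funext => v; rewrite ipE raddf_sum; apply: eq_bigr => j _.
  by case: (_ j 0) => a b; case: (_ j 0) => c d /=; ring.
apply: continuous_bigsum => j; apply: continuous_addr; apply: continuous_mulr;
  by [exact: continuous_Re_mul_emb|exact: continuous_Im_mul_emb].
Qed.

Lemma continuous_sq_mul_emb m (A : 'M[C]_(m, n)) :
  continuous (fun v => sq (A *m emb v)).
Proof. exact: continuous_Re_ip_emb. Qed.

Lemma continuous_sq_emb : continuous (fun v => sq (emb v)).
Proof.
have := @continuous_sq_mul_emb _ 1%:M.
by under eq_fun do rewrite mul1mx.
Qed.

(** Heine-Borel: the square of each real coordinate is at most [sq (emb v) = 1], and the sphere is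
    the preimage of a closed point under a continuous map. *)
Lemma compact_sphere : compact [set v | sq (emb v) = 1]%classic.
Proof.
apply: bounded_closed_compact.
  exists 1; split => // M M1 v /= v1; rewrite [leLHS]/Num.Def.normr /= mx_normrE.
  have M0 : 0 <= M by apply: le_trans (ltW M1).
  apply/bigmax_leP; split=> // -[i j] _ /=; apply: le_trans (ltW M1).
  rewrite -ler_sqr ?nnegrE // real_normK ?num_real //.
  rewrite expr1n -v1 sqE ord1.
  have h k : 0 <= Re (emb v k 0) ^+ 2 + Im (emb v k 0) ^+ 2.
    by rewrite addr_ge0 // sqr_ge0.
  case: (split_ordP j) => k ->; rewrite (bigD1 k) //= mxE /=.
    by rewrite -addrA lerDl addr_ge0 ?sqr_ge0 ?sumr_ge0.
  by rewrite -addrA addrCA lerDl addr_ge0 ?sqr_ge0 ?sumr_ge0.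
have -> : [set v | sq (emb v) = 1]%classic =
  ((fun v => sq (emb v)) @^-1` [set (1 : R)])%classic by [].
by apply: closed_comp; [move=> v _; exact: continuous_sq_emb|exact: closed_eq].
Qed.

Lemma sphere_EVT_min (F : 'cV[C]_n -> R) : (0 < n)%N ->
  continuous (F \o emb) ->
  exists2 x, sq x = 1 & forall y, sq y = 1 -> F x <= F y.
Proof.
move=> n0 cF; have [||c] := @compact_EVT_min _ R (F \o emb) _ _ compact_sphere.
- have [v vE] := emb_surj (delta_mx (Ordinal n0) 0); exists v => /=.
  rewrite vE sqE (bigD1 (Ordinal n0)) //= big1 => [|k k0]; rewrite !mxE ?eqxx.
    by rewrite /= expr1n expr0n !addr0.
  by rewrite (negPf k0) /= expr0n addr0.
- exact: continuous_subspaceT.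
rewrite inE => /= c1 cmin; exists (emb c) => // y.
by have [v <-] := emb_surj y => v1; apply: cmin; rewrite inE.
Qed.

End Dim.
End Sphere.

(** * Norm-attaining vectors and Birkhoff-James orthogonality *)

Section OpNorm.
Variables (R : realType) (n : nat).
Hypothesis n0 : (0 < n)%N.
Local Notation C := R[i].
Implicit Types (A B : 'M[C]_n) (x y z : 'cV[C]_n).

(** The condition is homogeneous in [x], so norming vectors need not be normalised and 0 counts as
    one. *)
Definition attains A x : Prop := sq (A *m x) = opnorm A ^+ 2 * sq x.

Lemma nsq_real (a : R) : nsq a%:C%C = a ^+ 2.
Proof. by rewrite /nsq /= expr0n addr0. Qed.

Lemma sq_normalize x : x != 0 -> sq ((Num.sqrt (sq x))^-1%:C%C *: x) = 1.
Proof.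
move=> x0; rewrite sqZ nsq_real exprVn sqr_sqrtr ?sq_ge0 // mulVf //.
by rewrite sq_eq0.
Qed.

(** The supremum is a maximum: [sq (A *m x)] reaches its largest value on the compact sphere, and
    homogeneity extends the bound to all vectors. *)
Lemma opnorm_spec A : [/\ 0 <= opnorm A, exists2 x, sq x = 1 & attains A x &
  forall y, sq (A *m y) <= opnorm A ^+ 2 * sq y].
Proof.
have cF : continuous ((fun x => 0 - sq (A *m x)) \o @emb R n).
  apply: continuous_subr => [v|]; first exact: cst_continuous.
  exact: continuous_sq_mul_emb.
have [x0 x1 xmin] := sphere_EVT_min n0 cF.
have le y : sq (A *m y) <= sq (A *m x0) * sq y.
  have [->|y0] := eqVneq y 0; first by rewrite mulmx0 /sq !ip0r mulr0.
  have := xmin _ (sq_normalize y0); rewrite !sub0r lerN2 -scalemxAr sqZ nsq_real.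
  rewrite exprVn sqr_sqrtr ?sq_ge0 // mulrC ler_pdivrMr ?sq_gt0 //.
have E : opnorm A = Num.sqrt (sq (A *m x0)).
  apply/eqP; rewrite eq_le; apply/andP; split.
    apply: ge_sup; first by exists (vnorm (A *m 0)), 0; rewrite //= vnorm_sq /sq ip0r sqrtr0.
    move=> _ /= [y + <-]; rewrite !vnorm_sq => y1; rewrite ler_wsqrtr //.
    apply: le_trans (le y) _; rewrite ler_piMr ?sq_ge0 //.
    by move: y1; rewrite -[leRHS]sqrtr1 ler_psqrt ?nnegrE ?sq_ge0.
  rewrite -vnorm_sq; apply: ub_le_sup; last first.
    by exists x0 => //=; rewrite vnorm_sq x1 sqrtr1.
  exists (Num.sqrt (sq (A *m x0))) => _ /= [y + <-]; rewrite !vnorm_sq => y1.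
  rewrite ler_wsqrtr //.
  apply: le_trans (le y) _; rewrite ler_piMr ?sq_ge0 //.
  by move: y1; rewrite -[leRHS]sqrtr1 ler_psqrt ?nnegrE ?sq_ge0.
rewrite E sqr_sqrtr ?sq_ge0 //; split => //; first exact: sqrtr_ge0.
by exists x0; rewrite // /attains E x1 mulr1 sqr_sqrtr ?sq_ge0.
Qed.

Lemma opnorm_ge0 A : 0 <= opnorm A. Proof. by have [] := opnorm_spec A. Qed.

Lemma opnorm_attained A : exists2 x, x != 0 & attains A x.
Proof.
have [_ [x x1 xA] _] := opnorm_spec A; exists x => //.
by rewrite -sq_eq0 x1 oner_eq0.
Qed.

Lemma sq_mul_le A y : sq (A *m y) <= opnorm A ^+ 2 * sq y.
Proof. by have [_ _ ->] := opnorm_spec A. Qed.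

Lemma opnorm_le A (c : R) : 0 <= c ->
  (forall x, sq (A *m x) <= c ^+ 2 * sq x) -> opnorm A <= c.
Proof.
move=> c0 h; have [a0 [x x1 xA] _] := opnorm_spec A.
by have := h x; rewrite xA x1 !mulr1 ler_sqr ?nnegrE.
Qed.

Lemma opnorm_lt A (c : R) : 0 <= c ->
  (forall x, sq x = 1 -> sq (A *m x) < c ^+ 2) -> opnorm A < c.
Proof.
move=> c0 h; have [a0 [x x1 xA] _] := opnorm_spec A.
by have := h x x1; rewrite xA x1 !mulr1 ltr_sqr ?nnegrE.
Qed.

Lemma opnorm_eq A B : (forall x, sq (A *m x) = sq (B *m x)) -> opnorm A = opnorm B.
Proof.
move=> h; apply/eqP; rewrite eq_le; apply/andP.
by split; apply: opnorm_le (opnorm_ge0 _) _ => x; [rewrite h|rewrite -h];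
  exact: sq_mul_le.
Qed.

Lemma opnorm_eq0 A : (opnorm A == 0) = (A == 0).
Proof.
apply/eqP/eqP => [A0|->].
  apply: mulmx_ext => x; rewrite mul0mx; apply/eqP; rewrite -sq_eq0.
  by rewrite eq_le sq_ge0 andbT; have := sq_mul_le A x; rewrite A0 expr0n mul0r.
apply/eqP; rewrite eq_le opnorm_ge0 andbT; apply: opnorm_le => // x.
by rewrite mul0mx /sq ip0r expr0n mul0r.
Qed.

Lemma attains_mul_neq0 A x : A != 0 -> x != 0 -> attains A x -> A *m x != 0.
Proof.
move=> A0 x0 xA; rewrite -sq_eq0 xA mulf_neq0 ?sq_eq0 //.
by rewrite expf_neq0 // opnorm_eq0.
Qed.

(* A nonnegative quadratic form has no mixed terms with its isotropic vectors. *)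
Lemma attains_ip A x z : attains A x ->
  ip (A *m x) (A *m z) = (opnorm A ^+ 2)%:C%C * ip x z.
Proof.
move=> xA; apply/eqP; rewrite eq_sym -subr_eq0; set b := _ - _.
pose Q := opnorm A ^+ 2 * sq z - sq (A *m z).
have Q0 : 0 <= Q by rewrite subr_ge0 sq_mul_le.
(* The form [opnorm A ^+ 2 * sq v - sq (A *m v)] vanishes at [x]. It is evaluated at [x + t *: z],
   with [t] chosen so that the mixed term becomes the real number [- 2 * s * nsq b]. *)
have key s : 0 <= s ^+ 2 * nsq b * Q - 2 * s * nsq b.
  pose t := - (s%:C%C * conjc b).
  have := sq_mul_le A (x + t *: z).
  rewrite mulmxDr -scalemxAr !sqD !sqZ !ipZr xA.
  have -> : nsq t = s ^+ 2 * nsq b.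
    by rewrite /t /nsq; case: (b) => u v /=; ring.
  have : Re (t * b) = - s * nsq b.
    by rewrite /t /nsq; case: (b) => u v /=; ring.
  rewrite /b mulrBr raddfB /= mulrCA.
  have -> (c : R) (w : C) : Re (c%:C%C * w) = c * Re w by case: w => u v /=; ring.
  rewrite /Q; move: (Re _) (Re _) => u v; nra.
(* Multiplied by [(Q + 1) ^+ 2], this instance reads [0 <= - (Q + 2) * nsq b], which forces
   [b = 0]. *)
have := key (Q + 1)^-1; rewrite -nsq_eq0 => h.
have N0 := nsq_ge0 b; apply/eqP.
have Qp : 0 < Q + 1 by lra.
have : 0 <= (Q + 1) ^+ 2 * ((Q + 1)^-1 ^+ 2 * nsq b * Q - 2 * (Q + 1)^-1 * nsq b).
  by rewrite mulr_ge0 // sqr_ge0.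
have -> : (Q + 1) ^+ 2 * ((Q + 1)^-1 ^+ 2 * nsq b * Q - 2 * (Q + 1)^-1 * nsq b) =
   nsq b * Q - 2 * (Q + 1) * nsq b by field; rewrite gt_eqF.
nra.
Qed.

(** The condition on the right is conjugate-linear in [x], so the norming vectors form a
    subspace. *)
Lemma attainsP A x : attains A x <->
  forall z, ip (A *m x) (A *m z) = (opnorm A ^+ 2)%:C%C * ip x z.
Proof.
split=> [h z|/(_ x)]; first exact: attains_ip.
by rewrite !ip_sq -rmorphM => /complexI.
Qed.

Lemma attainsD A x y a : attains A x -> attains A y -> attains A (x + a *: y).
Proof.
move=> /attainsP hx /attainsP hy; apply/attainsP => z.
by rewrite mulmxDr -scalemxAr !(ipDl, ipZl) hx hy; ring.
Qed.

Lemma attainsZ A x a : attains A x -> attains A (a *: x).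
Proof. by rewrite /attains -scalemxAr !sqZ => ->; rewrite mulrCA. Qed.

(** The easy half of the Bhatia-Semrl theorem: by Pythagoras [(A + l *: B) *m x] is at least as long
    as [A *m x]. *)
Lemma BJorth_attains A B x : x != 0 -> attains A x ->
  ip (A *m x) (B *m x) = 0 -> BJorth A B.
Proof.
move=> x0 xA xB l; have := sq_mul_le (A + l *: B) x.
rewrite mulmxDl -scalemxAl sqD ipZr xB mulr0 mulr0 addr0 sqZ xA => h.
have : opnorm A ^+ 2 * sq x <= opnorm (A + l *: B) ^+ 2 * sq x.
  by apply: le_trans h; rewrite lerDl mulr_ge0 ?nsq_ge0 ?sq_ge0.
have x1 : 0 < sq x by rewrite sq_gt0.
rewrite (ler_pM2r x1).
by rewrite ler_pXn2r // nnegrE opnorm_ge0.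
Qed.

(* [P], [T], [Q] stand for [|Az|^2], [|Bz|^2] and [Re <Az, Bz>]. *)
Lemma perturbation_decreases (a b d P T Q : R) :
  0 < d -> 0 <= P <= a -> 0 <= T <= b -> 0 <= P + T + 2 * Q ->
  d <= a - P \/ d <= Q ->
  P + (d / (a + 2 * b + 1 + d)) ^+ 2 * T - 2 * (d / (a + 2 * b + 1 + d)) * Q < a.
Proof.
move=> d0 /andP[P0 Pa] /andP[T0 Tb] PTQ.
have dp : 0 < a + 2 * b + 1 + d by lra.
set e := _ / _; have e0 : 0 < e by rewrite divr_gt0.
have eE : e * (a + 2 * b + 1 + d) = d by rewrite /e divfK // gt_eqF.
clearbody e.
have ea : 0 <= e * a by apply: mulr_ge0; lra.
have eb : 0 <= e * b by apply: mulr_ge0; lra.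
have ed : 0 < e * d by apply: mulr_gt0.
have e1 : e < 1 by rewrite -(ltr_pM2r d0) mul1r; lra.
have e2 : e ^+ 2 * T <= e * (e * b).
  by rewrite expr2 -mulrA !ler_pM2l.
have e3 : e * (e * b) <= e * b by rewrite ler_piMl // ltW.
case=> h.
  (* Since [- 2 * Q <= P + T], the left side is at most [P + e * (a + 2 * b)], which is below
     [P + d <= a]. *)
  have : 0 <= e * (P + T + 2 * Q) by rewrite mulr_ge0 // ltW.
  have : e * P <= e * a by rewrite ler_pM2l.
  have : e * T <= e * b by rewrite ler_pM2l.
  lra.
(* Here [e * b < d], so the quadratic term stays below [e * d] and is outweighed by [2 * e * Q]. *)
have : e * d <= e * Q by rewrite ler_pM2l.
have : e * (e * b) < e * d by rewrite ltr_pM2l //; lra.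
lra.
Qed.

(** By compactness there is one [d > 0] such that at each unit vector either [sq (A *m z)] is below
    its maximum by [d] or the real part of [ip (A *m z) (B *m z)] is at least [d]. Subtracting a
    small multiple of [B] then lowers the norm of [A]. *)
Lemma not_BJorth A B :
  (forall z, z != 0 -> attains A z -> 0 < Re (ip (A *m z) (B *m z))) ->
  ~ BJorth A B.
Proof.
move=> h AB; set a := opnorm A ^+ 2; set b := opnorm B ^+ 2.
pose q x := Re (ip (A *m x) (B *m x)).
have cF : continuous ((fun x => Num.max (a - sq (A *m x)) (q x)) \o @emb R n).
  apply: continuous_maxr; last exact: continuous_Re_ip_emb.
  apply: continuous_subr => [v|]; first exact: cst_continuous.
  exact: continuous_sq_mul_emb.
have [x x1 xmin] := sphere_EVT_min n0 cF.
set d := Num.max _ _ in xmin.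
have d0 : 0 < d.
  rewrite /d lt_max; have [//|/= p0] := ltP 0 (a - sq (A *m x)).
  apply: h; first by rewrite -sq_eq0 x1 oner_eq0.
  by rewrite /attains x1; have := sq_mul_le A x; rewrite x1 -/a; lra.
set e := d / (a + 2 * b + 1 + d).
have := AB (- e%:C)%C; apply/negP; rewrite -ltNge.
apply: opnorm_lt (opnorm_ge0 _) _ => z z1.
have Az := sq_mul_le A z; have Bz := sq_mul_le B z.
have := sq_ge0 (A *m z + B *m z); rewrite sqD -/(q z) => qz.
rewrite z1 mulr1 in Az; rewrite z1 mulr1 in Bz.
rewrite mulmxDl -scalemxAl sqD ipZr sqZ -/a.
have -> : nsq (- e%:C)%C = e ^+ 2 by rewrite /nsq /=; ring.
have -> : Re ((- e%:C)%C * ip (A *m z) (B *m z)) = - e * q z.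
  by rewrite /q; case: (ip _ _) => u v /=; ring.
rewrite mulNr mulrN mulrA.
apply: (perturbation_decreases d0 _ _ qz).
- by rewrite sq_ge0 Az.
- by rewrite sq_ge0 Bz.
by have := xmin z z1; rewrite le_max => /orP.
Qed.

(** The choice [l = -1] cancels [A]. This makes 0 recognisable from orthogonality alone. *)
Lemma BJorth_self A : BJorth A A <-> A = 0.
Proof.
split=> [/(_ (-1))|->].
  have -> : A + -1 *: A = 0 by rewrite scaleN1r subrr.
  have /eqP -> : opnorm (0 : 'M[C]_n) == 0 by rewrite opnorm_eq0.
  by move=> h; apply/eqP; rewrite -opnorm_eq0 eq_le h opnorm_ge0.
by move=> l; rewrite scaler0 addr0.
Qed.

End OpNorm.

(** * Rank-one matrices *)

Local Opaque opnorm.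

Section RankOne.
Variables (R : realType) (n : nat).
Hypothesis n0 : (0 < n)%N.
Local Notation C := R[i].
Implicit Types (A B D : 'M[C]_n) (x y z u v : 'cV[C]_n).

Lemma nsqM (a b : C) : nsq (a * b) = nsq a * nsq b.
Proof. by case: a b => ? ? [? ?]; rewrite /nsq /=; ring. Qed.

Lemma nsqJ (a : C) : nsq (conjc a) = nsq a.
Proof. by case: a => ? ?; rewrite /nsq /=; ring. Qed.

(** The Gram-Schmidt residual, cleared of denominators: its nonnegativity is the Cauchy-Schwarz
    inequality, its vanishing the case of equality. *)
Lemma sq_residual x y :
  sq ((sq x)%:C%C *: y - ip x y *: x) = sq x * (sq x * sq y - nsq (ip x y)).
Proof.
rewrite -scaleNr sqD !sqZ ipZl ipZr (ipC x y) conjc_real nsq_real.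
have -> : Re ((sq x)%:C%C * (- ip x y * conjc (ip x y))) = - sq x * nsq (ip x y).
  by case: (ip x y) => a b; rewrite /nsq /=; ring.
have -> : nsq (- ip x y) = nsq (ip x y).
  by case: (ip x y) => a b; rewrite /nsq /=; ring.
ring.
Qed.

Lemma nsq_ip_le x y : nsq (ip x y) <= sq x * sq y.
Proof.
have [->|x0] := eqVneq x 0; first by rewrite ip0l /nsq /= expr0n addr0 mulr_ge0 ?sq_ge0.
have := sq_ge0 ((sq x)%:C%C *: y - ip x y *: x).
by rewrite sq_residual pmulr_rge0 ?sq_gt0 // subr_ge0.
Qed.

Lemma nsq_ip_eq x y : x != 0 -> nsq (ip x y) = sq x * sq y ->
  exists a, y = a *: x.
Proof.
move=> x0 h; exists ((sq x)%:C%C^-1 * ip x y).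
have /eqP : sq ((sq x)%:C%C *: y - ip x y *: x) = 0.
  by rewrite sq_residual h subrr mulr0.
rewrite sq_eq0 subr_eq0 => /eqP e.
rewrite -scalerA -e scalerA mulVf ?scale1r //.
by rewrite -ip_sq ip_eq0.
Qed.

Lemma opnorm_rk1 y x : opnorm (rk1 y x) ^+ 2 = sq x * sq y.
Proof.
have s0 : 0 <= sq x * sq y by rewrite mulr_ge0 ?sq_ge0.
apply/eqP; rewrite eq_le; apply/andP; split.
  rewrite -[leRHS]sqr_sqrtr // ler_pXn2r ?nnegrE ?sqrtr_ge0 ?(opnorm_ge0 n0) //.
  apply: (opnorm_le n0) => [|z]; first exact: sqrtr_ge0.
  rewrite sqr_sqrtr // rk1_mul sqZ mulrAC ler_wpM2r ?sq_ge0 //.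
  exact: nsq_ip_le.
have [->|x0] := eqVneq x 0; first by rewrite /sq ip0l mul0r sqr_ge0.
have := sq_mul_le n0 (rk1 y x) x.
rewrite rk1_mul sqZ ip_sq nsq_real expr2 -mulrA mulrC ler_pM2r ?sq_gt0 //.
Qed.

Lemma attains_rk1_self y x : attains (rk1 y x) x.
Proof. by rewrite /attains opnorm_rk1 rk1_mul sqZ ip_sq nsq_real; ring. Qed.

Lemma attains_rk1 y x z : x != 0 -> y != 0 -> attains (rk1 y x) z ->
  exists a, z = a *: x.
Proof.
move=> x0 y0; rewrite /attains opnorm_rk1 rk1_mul sqZ => h.
apply: nsq_ip_eq => //.
by have sy : sq y != 0; [rewrite sq_eq0|apply: (mulIf sy); rewrite h mulrAC].
Qed.

Lemma BJorthZr A B (c : C) : BJorth A B -> BJorth A (c *: B).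
Proof. by move=> h l; rewrite scalerA. Qed.

Lemma Re_conj_mul (a b : C) : Re (conjc a * (a * b)) = nsq a * Re b.
Proof. by case: a b => ? ? [? ?]; rewrite /nsq /=; ring. Qed.

Lemma BJorth_line A B x : x != 0 -> attains A x ->
  (forall z, attains A z -> exists a, z = a *: x) ->
  BJorth A B <-> ip (A *m x) (B *m x) = 0.
Proof.
move=> x0 xA hx; split=> [AB|]; last exact: BJorth_attains.
(* Multiplying [B] by the conjugate of the nonzero inner product makes that inner product positive
   along the whole line of norming vectors. *)
apply/eqP; apply/negPn/negP => c0; move: (AB) => /(BJorthZr (conjc (ip (A *m x) (B *m x)))).
apply: not_BJorth => // z z0 /hx [a za].
rewrite za -!scalemxAr -scalemxAl ipZl !ipZr Re_conj_mul -nsqE /=.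
rewrite mulr_gt0 // nsq_gt0 //.
by apply: contra_neq z0 => a0; rewrite za a0 scale0r.
Qed.

Lemma BJorth_rk1 y x B : x != 0 -> y != 0 ->
  BJorth (rk1 y x) B <-> ip y (B *m x) = 0.
Proof.
move=> x0 y0; rewrite (BJorth_line _ x0 (attains_rk1_self y x)); last first.
  by move=> z; exact: attains_rk1.
rewrite rk1_mul ipZl ip_sq conjc_real; split=> [/eqP|->]; last by rewrite mulr0.
by rewrite mulf_eq0 -ip_sq ip_eq0 (negPf x0) /= => /eqP.
Qed.

Lemma neq0_scaler (a : C) x y : y != 0 -> y = a *: x -> a != 0 /\ x != 0.
Proof.
move=> y0 e; split; first by apply: contra_neq y0 => a0; rewrite e a0 scale0r.
by apply: contra_neq y0 => a0; rewrite e a0 scaler0.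
Qed.

(** In the application, [P <= S] and [Q * T <= N] are Cauchy-Schwarz inequalities and [S <= M] is
    the operator norm bound. *)
Lemma product_equality (P Q S T M N : R) :
  0 < M -> 0 < N -> 0 <= P <= S -> S <= M -> 0 <= Q * T <= N -> M * N <= P * (Q * T) ->
  P = S /\ S = M.
Proof.
move=> M0 N0 /andP[P0 PS] SM /andP[QT0 QTN] h.
have : P * (Q * T) <= P * N by rewrite ler_wpM2l.
move=> h2; have : M * N <= P * N by lra.
rewrite ler_pM2r // => MP; lra.
Qed.

Lemma rk1_BJorth_sub A x y : A != 0 -> x != 0 -> y != 0 ->
  (forall B, BJorth (rk1 y x) B -> BJorth A B) <->
  attains A x /\ exists c, y = c *: (A *m x).
Proof.
move=> A0 x0 y0; split=> [h|[xA [c yc]] B]; last first.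
  rewrite BJorth_rk1 // yc ipZl => /eqP; rewrite mulf_eq0 conjc_eq0.
  have [/negPf -> _] := neq0_scaler y0 yc; move=> /= /eqP.
  exact: BJorth_attains.
have sx : 0 < sq x by rewrite sq_gt0.
have sy : 0 < sq y by rewrite sq_gt0.
set l := ip y (A *m x).
(* The part of [A] in the hyperplane of matrices to which [rk1 y x] is orthogonal, scaled to avoid a
   division. *)
pose B := (sq x * sq y)%:C%C *: A - l *: rk1 y x.
have /h AB : BJorth (rk1 y x) B.
  rewrite BJorth_rk1 // /B mulmxBl -!scalemxAl rk1_mul ipBr !ipZr !ip_sq -/l.
  by rewrite rmorphM /=; ring.
have [z z0 zA] : exists2 z, z != 0 & attains A z /\ Re (ip (A *m z) (B *m z)) <= 0.
  apply: contrapT => hz; apply: not_BJorth AB => // z z0 zA.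
  rewrite ltNge; apply/negP => hz2; by apply: hz; exists z.
case: zA => zA.
have sz : 0 < sq z by rewrite sq_gt0.
have sA : 0 < opnorm A ^+ 2.
  rewrite exprn_even_gt0 //= opnorm_eq0 //.
have [mu muE] : exists mu, mu = opnorm A ^+ 2 by exists (opnorm A ^+ 2).
rewrite -muE in sA.
rewrite /B mulmxBl -!scalemxAl rk1_mul ipBr !ipZr ip_sq raddfB /= mul0r subr0.
rewrite zA -muE; set w := l * (ip x z * ip (A *m z) y) => hw.
have K : (sq x * sq y) * (mu * sq z) <= Re w by lra.
have {}K : ((sq x * sq y) * (mu * sq z)) ^+ 2 <= nsq w.
  rewrite /nsq; apply: le_trans (_ : Re w ^+ 2 <= _); last by rewrite lerDl sqr_ge0.
  have K0 : 0 <= sq x * sq y * (mu * sq z) by apply: ltW; rewrite !mulr_gt0.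
  by rewrite ler_pXn2r // nnegrE // (le_trans K0).
have cz := nsq_ip_le x z; have cy := nsq_ip_le (A *m z) y.
rewrite zA -muE in cy; rewrite /w !nsqM in K.
(* By [K] the product reaches the product of its upper bounds, so the Cauchy-Schwarz inequality for
   [y] and [A *m x] and the norm bound at [x] are equalities. *)
have [||||||e1 e2] := @product_equality (nsq l) (nsq (ip x z)) (sq y * sq (A *m x))
   (nsq (ip (A *m z) y)) (sq y * (mu * sq x)) ((sq x * sq z) * (mu * sq z * sq y)).
- by rewrite !mulr_gt0.
- by rewrite !mulr_gt0.
- by rewrite nsq_ge0 nsq_ip_le.
- by rewrite ler_pM2l // muE sq_mul_le.
- by rewrite mulr_ge0 ?nsq_ge0 // ler_pM ?nsq_ge0.
- by apply: le_trans K; rewrite le_eqVlt; apply/orP; left; apply/eqP; ring.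
have xA : attains A x by move: e2 => /(mulfI (lt0r_neq0 sy)); rewrite muE.
split=> //; apply: nsq_ip_eq; first exact: attains_mul_neq0.
by rewrite (ipC y) nsqJ e1 mulrC.
Qed.

(* A nonzero [A] is smooth when the set of all [B] to which it is orthogonal is
   minimal; equivalently, [A] attains its norm along a single line. *)
Definition nonsmooth A : Prop := exists B, [/\ B != 0,
  forall D, BJorth B D -> BJorth A D & ~ (forall D, BJorth A D -> BJorth B D)].

(** Let [B] attain its norm at [z]. Then so does [A], with [B *m z] proportional to [A *m z]. If [A]
    attained its norm only along [z], then [A] being orthogonal to [D] would mean
    [ip (A *m z) (D *m z) = 0], so [B] would be orthogonal to [D] too, against the choice of [B]. *)
Lemma nonsmooth_attains A : A != 0 -> nonsmooth A ->
  exists z x, [/\ z != 0, attains A z, attains A x & forall a, x <> a *: z].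
Proof.
move=> A0 [B [B0 BA nAB]].
have [z z0 zB] := opnorm_attained n0 B.
have Bz0 := attains_mul_neq0 n0 B0 z0 zB.
have [zA [c Bzc]] : attains A z /\ exists c, B *m z = c *: (A *m z).
  apply/(rk1_BJorth_sub A0 z0 Bz0) => D; move=> /(BJorth_rk1 D z0 Bz0) zD.
  by apply: BA; apply: BJorth_attains zD.
apply: contrapT => hx; apply: nAB => D.
rewrite (BJorth_line D z0 zA) => [zD|y yA].
  by apply: BJorth_attains z0 zB _ => //; rewrite Bzc ipZl zD mulr0.
apply: contrapT => hy; apply: hx; exists z, y; split => // a ya.
by apply: hy; exists a.
Qed.

Lemma rk1_nonsmooth v u A : nonsmooth A -> BJorth A (rk1 v u).
Proof.
have [->|A0] := eqVneq A 0.
  by move=> _ l; have /eqP -> : opnorm (0 : 'M[C]_n) == 0; rewrite ?opnorm_eq0 ?opnorm_ge0.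
case/(nonsmooth_attains A0) => z [x [z0 zA xA xz]].
have [w w0 [wA uw]] : exists2 w, w != 0 & attains A w /\ ip u w = 0.
  have [uz|uz] := eqVneq (ip u z) 0; first by exists z.
  (* The combination of the two norming vectors that is orthogonal to [u]. *)
  exists (x + (- (ip u x / ip u z)) *: z).
    by rewrite scaleNr subr_eq0; apply/eqP; exact: xz.
  by split; [exact: attainsD|rewrite ipDr ipZr mulNr divfK // subrr].
by apply: BJorth_attains w0 wA _; rewrite // rk1_mul uw scale0r ip0r.
Qed.

(** * Partial isometries of rank two *)

Section Frames.
Variables e1 e2 f1 f2 : 'cV[C]_n.
Hypotheses (e11 : sq e1 = 1) (e22 : sq e2 = 1) (e12 : ip e1 e2 = 0).
Hypotheses (f11 : sq f1 = 1) (f22 : sq f2 = 1) (f12 : ip f1 f2 = 0).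
Let A := rk1 f1 e1 + rk1 f2 e2.

Lemma frame_mul x : A *m x = ip e1 x *: f1 + ip e2 x *: f2.
Proof. by rewrite mulmxDl !rk1_mul. Qed.

Lemma sq_frame_mul x : sq (A *m x) = nsq (ip e1 x) + nsq (ip e2 x).
Proof. by rewrite frame_mul sqD !sqZ f11 f22 ipZl ipZr f12 !mulr0 !mulr1 addr0. Qed.

(** Bessel's identity. Its left side vanishes exactly on the span of [e1] and [e2], where [A]
    attains its norm 1. *)
Lemma sq_frame_defect x : sq (x - (ip e1 x *: e1 + ip e2 x *: e2)) =
  sq x - (nsq (ip e1 x) + nsq (ip e2 x)).
Proof.
rewrite -scaleN1r sqD sqZ sqD !sqZ e11 e22 !(ipZl, ipZr, ipDr) e12 (ipC e1 x) (ipC e2 x).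
by case: (ip e1 x) (ip e2 x) => a b [c d]; rewrite /nsq /=; ring.
Qed.

Lemma opnorm_frame : opnorm A ^+ 2 = 1.
Proof.
apply/eqP; rewrite eq_le; apply/andP; split.
  rewrite expr_le1 ?opnorm_ge0 //; apply: opnorm_le => // x.
  rewrite expr1n mul1r sq_frame_mul -subr_ge0 -sq_frame_defect; exact: sq_ge0.
have := sq_mul_le n0 A e1; rewrite sq_frame_mul ip_sq e11 (ipC e1 e2) e12.
by rewrite conjc0 /nsq /= expr1n expr0n !addr0 mulr1.
Qed.

Lemma attains_frame x : attains A x <-> x = ip e1 x *: e1 + ip e2 x *: e2.
Proof.
rewrite /attains opnorm_frame mul1r sq_frame_mul; split=> [h|h].
  by apply/eqP; rewrite -subr_eq0 -sq_eq0 sq_frame_defect h subrr.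
apply/esym/eqP; rewrite -subr_eq0 -sq_frame_defect -h subrr sq_eq0 //.
Qed.

End Frames.

Lemma unit_multiple x : x != 0 -> exists2 t : R, 0 < t & sq (t%:C%C *: x) = 1.
Proof.
move=> x0; exists (Num.sqrt (sq x))^-1; last exact: sq_normalize.
by rewrite invr_gt0 sqrtr_gt0 sq_gt0.
Qed.

(** Take a norming vector [e] of [B]. If [B] vanished on the orthogonal complement of [e], it would
    have the form [rk1 y x]. Otherwise some [z] orthogonal to [e] has a nonzero image, which is
    orthogonal to [B *m e] because [e] is norming. *)
Lemma rank_ge2_orthonormal B : ~ (exists y x, B = rk1 y x) -> exists e1 e2,
  [/\ sq e1 = 1, sq e2 = 1, ip e1 e2 = 0 &
   [/\ B *m e1 != 0, B *m e2 != 0 & ip (B *m e1) (B *m e2) = 0]].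
Proof.
move=> hB; have [e e0 eB] := opnorm_attained n0 B.
have [h|] := pselect (forall z, ip e z = 0 -> B *m z = 0).
  case: hB.
  exists ((sq e)%:C%C^-1 *: (B *m e)), e; apply: mulmx_ext => x; rewrite rk1_mul.
  apply/eqP; rewrite scalerA scalemxAr -subr_eq0 -mulmxBr; apply/eqP; apply: h.
  by rewrite ipBr ipZr -ip_sq divfK ?subrr // ip_eq0.
move=> /existsNP [z /not_implyP [ez Bz]].
have Bz0 : B *m z != 0 by apply/eqP.
have z0 : z != 0 by apply: contra_neq Bz0 => ->; rewrite mulmx0.
have B0 : B != 0 by apply: contra_neq Bz0 => ->; rewrite mul0mx.
have Be0 := attains_mul_neq0 n0 B0 e0 eB.
have Bez : ip (B *m e) (B *m z) = 0 by rewrite (attains_ip n0 z eB) ez mulr0.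
have [s s0 es] := unit_multiple e0; have [t t0 zt] := unit_multiple z0.
have nz (r : R) : 0 < r -> r%:C%C != 0 :> C.
  by move=> r0; rewrite (inj_eq (@complexI R)) gt_eqF.
exists (s%:C%C *: e), (t%:C%C *: z); split => //; first by rewrite ipZl ipZr ez !mulr0.
by split; rewrite -!scalemxAr ?ipZl ?ipZr ?Bez ?mulr0 // scaler_eq0 negb_or nz.
Qed.

(** The witness is [rk1 (A *m x) x]. Were the inclusion reversible, [rk1 (A *m x) x] would attain
    its norm at [z] too, making [z] a multiple of the orthogonal vector [x]. *)
Lemma nonsmooth_intro A x z : A != 0 -> x != 0 -> z != 0 -> ip x z = 0 ->
  attains A x -> attains A z -> nonsmooth A.
Proof.
move=> A0 x0 z0 xz xA zA.
have Ax0 := attains_mul_neq0 n0 A0 x0 xA.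
have Az0 := attains_mul_neq0 n0 A0 z0 zA.
have h0 : rk1 (A *m x) x != 0.
  apply/eqP => h; have := rk1_mul (A *m x) x x; rewrite h mul0mx => /esym/eqP.
  by rewrite scaler_eq0 ip_eq0 (negPf x0) (negPf Ax0).
exists (rk1 (A *m x) x); split; first exact: h0.
  by apply/(rk1_BJorth_sub A0 x0 Ax0); split; [exact: xA|exists 1; rewrite scale1r].
move=> h.
have sub : forall D, BJorth (rk1 (A *m z) z) D -> BJorth (rk1 (A *m x) x) D.
  move=> D D2; apply: h; move: D D2.
  by apply/(rk1_BJorth_sub A0 z0 Az0); split; [exact: zA|exists 1; rewrite scale1r].
have [+ _] := (rk1_BJorth_sub h0 z0 Az0).1 sub.
move=> /(attains_rk1 x0 Ax0) [a za].
have : ip z z = 0 by rewrite {2}za ipZr (ipC x) xz conjc0 mulr0.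
by move/eqP; rewrite ip_eq0 (negPf z0).
Qed.

(** If [B] is not of this form, let [A] send orthonormal [e1], [e2] to the normalised vectors
    [B *m e1], [B *m e2]. This [A] is nonsmooth, yet [ip (A *m x) (B *m x)] is positive at all its
    nonzero norming vectors, so [A] is not orthogonal to [B]. *)
Lemma rk1P B : (forall A, nonsmooth A -> BJorth A B) -> exists y x, B = rk1 y x.
Proof.
move=> hB; apply: contrapT => /rank_ge2_orthonormal [e1 [e2 [e11 e22 e12]]].
move=> [w10 w20]; set w1 := B *m e1; set w2 := B *m e2 => w12.
have [t1 t10 f11] := unit_multiple w10; have [t2 t20 f22] := unit_multiple w20.
rewrite -/w1 in w10 f11; rewrite -/w2 in w20 f22.
have f12 : ip (t1%:C%C *: w1) (t2%:C%C *: w2) = 0 by rewrite ipZl ipZr w12 !mulr0.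
have aA := attains_frame e11 e22 e12 f11 f22 f12.
have Amul := frame_mul e1 e2 (t1%:C%C *: w1) (t2%:C%C *: w2).
have A1 := opnorm_frame e11 e22 e12 f11 f22 f12.
move: (rk1 _ _ + rk1 _ _) => A in aA Amul A1.
have e10 : e1 != 0 by rewrite -sq_eq0 e11 oner_eq0.
have e20 : e2 != 0 by rewrite -sq_eq0 e22 oner_eq0.
have A0 : A != 0.
  by rewrite -(opnorm_eq0 n0) -sqrf_eq0 A1 oner_eq0.
have nsA : nonsmooth A.
  apply: (nonsmooth_intro A0 e10 e20 e12); apply/aA.
    by rewrite ip_sq e11 (ipC e1) e12 conjc0 scale0r addr0 scale1r.
  by rewrite ip_sq e22 e12 scale0r add0r scale1r.
apply: (not_BJorth n0 _ (hB A nsA)) => x x0 /aA xE.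
have -> : B *m x = ip e1 x *: w1 + ip e2 x *: w2.
  by rewrite {1}xE mulmxDr -!scalemxAr.
rewrite Amul; clearbody w1 w2.
move: (ip e1 x) (ip e2 x) xE => a b xE.
rewrite ipDl !ipDr !ipZl !ipZr w12 (ipC w1 w2) w12 conjc0 !mulr0 addr0 add0r !ip_sq.
have -> : Re (conjc a * (conjc t1%:C%C * (a * (sq w1)%:C%C)) +
    conjc b * (conjc t2%:C%C * (b * (sq w2)%:C%C))) =
    t1 * sq w1 * nsq a + t2 * sq w2 * nsq b.
  by case: a b {xE} => ? ? [? ?]; rewrite /nsq /=; ring.
have s1 : 0 < t1 * sq w1 by rewrite mulr_gt0 // sq_gt0.
have s2 : 0 < t2 * sq w2 by rewrite mulr_gt0 // sq_gt0.
have [p0|p0] := eqVneq a 0; last first.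
  by apply: ltr_wpDr; [apply: mulr_ge0 (ltW s2) (nsq_ge0 _)|rewrite mulr_gt0 ?nsq_gt0].
apply: ltr_wpDl; first exact: mulr_ge0 (ltW s1) (nsq_ge0 _).
rewrite mulr_gt0 // nsq_gt0; apply: contra_neq x0 => q0.
by rewrite xE p0 q0 !scale0r addr0.
Qed.

End RankOne.

(** * Maps preserving rows and columns of a grid *)

Section Rook.
Variables (V : Type) (nz : V -> Prop) (E : V -> V -> Prop).
Hypotheses (Er : forall x, E x x) (Es : forall x y, E x y -> E y x).
Hypothesis Et : forall y x z, E x y -> E y z -> E x z.
Hypothesis two : forall x, nz x -> exists2 x', nz x' & ~ E x x'.

(** Squares of a board, with coordinates up to [E]: lying on a common line and being equal are both
    preserved and reflected. *)
Definition rook_morphism (X Y : V -> V -> V) : Prop :=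
  forall x1 y1 x2 y2, nz x1 -> nz y1 -> nz x2 -> nz y2 ->
  ((E (X x1 y1) (X x2 y2) \/ E (Y x1 y1) (Y x2 y2)) <-> (E x1 x2 \/ E y1 y2)) /\
  ((E (X x1 y1) (X x2 y2) /\ E (Y x1 y1) (Y x2 y2)) <-> (E x1 x2 /\ E y1 y2)).

(** If [(x, y1)] and [(x, y2)] had images agreeing only in [Y], then for an inequivalent [x2] the
    image of [(x2, y1)] would share that [Y] too. So [(x2, y1)] and [(x, y2)] would lie on a common
    line. *)
Lemma rook_half X Y : rook_morphism X Y ->
  (forall x1 x2 y, nz x1 -> nz x2 -> nz y -> E (Y x1 y) (Y x2 y)) ->
  forall x y1 y2, nz x -> nz y1 -> nz y2 -> E (X x y1) (X x y2).
Proof.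
move=> h hY x y1 y2 nx n1 n2.
have [e12|ne12] := pselect (E y1 y2).
  by have [_ [_ []]] := h x y1 x y2 nx n1 nx n2.
have [x2 nx2 nxx2] := two nx.
have [[_ h1] _] := h x y1 x y2 nx n1 nx n2.
have [//|eY] : E (X x y1) (X x y2) \/ E (Y x y1) (Y x y2) by apply: h1; left.
have [[h2 _] _] := h x2 y1 x y2 nx2 n1 nx n2.
have [e|//] : E x2 x \/ E y1 y2.
  by apply: h2; right; apply: (Et _ eY); exact: hY.
by case: nxx2; exact: Es.
Qed.

Lemma rook_swap X Y : rook_morphism X Y -> rook_morphism Y X.
Proof.
move=> h x1 y1 x2 y2 n1 m1 n2 m2; have [h1 h2] := h x1 y1 x2 y2 n1 m1 n2 m2.
by split; [rewrite -h1|rewrite -h2]; split=> -[]; tauto.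
Qed.

Lemma rook_dichotomy X Y : rook_morphism X Y ->
  ((forall x1 x2 y, nz x1 -> nz x2 -> nz y -> E (Y x1 y) (Y x2 y)) /\
   (forall x y1 y2, nz x -> nz y1 -> nz y2 -> E (X x y1) (X x y2))) \/
  ((forall x1 x2 y, nz x1 -> nz x2 -> nz y -> E (X x1 y) (X x2 y)) /\
   (forall x y1 y2, nz x -> nz y1 -> nz y2 -> E (Y x y1) (Y x y2))).
Proof.
move=> h.
have [hY|] := pselect (forall x1 x2 y, nz x1 -> nz x2 -> nz y -> E (Y x1 y) (Y x2 y)).
  by left; split=> //; exact: rook_half h hY.
move=> nY; right.
have [x1 [x2 [y0 [n1 n2 m0 nE]]]] : exists x1 x2 y,
    [/\ nz x1, nz x2, nz y & ~ E (Y x1 y) (Y x2 y)].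
  apply: contrapT => hn; apply: nY => x1 x2 y ? ? ?; apply: contrapT => ne.
  by apply: hn; exists x1, x2, y.
suff hX : forall x1 x2 y, nz x1 -> nz x2 -> nz y -> E (X x1 y) (X x2 y).
  by split=> //; exact: rook_half (rook_swap h) hX.
have row x x' y : nz x -> nz x' -> nz y ->
    E (X x y) (X x' y) \/ E (Y x y) (Y x' y).
  by move=> nx nx' ny; have [[_ h1] _] := h x y x' y nx ny nx' ny; apply: h1; right.
(* As [Y] separates [x1] from [x2] on the line [y0], each point there shares its [X] with [x1] or
   with [x2], and these two share theirs. *)
have step1 x : nz x -> E (X x y0) (X x1 y0).
  move=> nx; have [//|e1] := row x x1 y0 nx n1 m0.
  have [e2|e2] := row x x2 y0 nx n2 m0; last by case: nE; exact: Et (Es e1) e2.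
  have [e3|//] := row x1 x2 y0 n1 n2 m0.
  exact: Et e2 (Es e3).
move=> x x' y nx nx' ny; apply: contrapT => nEX.
have [//|eY] := row x x' y nx nx' ny.
have nxx : ~ E x x'.
  by move=> e; apply: nEX; have [_ [_ []]] := h x y x' y nx ny nx' ny.
have nyy : ~ E y0 y.
  move=> e; apply: nEX; have [_ [_ []]] := h x y0 x y nx m0 nx ny => // ex _.
  have [_ [_ []]] := h x' y0 x' y nx' m0 nx' ny => // ex' _.
  exact: Et (Es ex) (Et (step1 _ nx) (Et (Es (step1 _ nx')) ex')).
(* The images of [(x, y0)] and [(x, y)] agree in [X] or in [Y]. Either way two squares differing in
   both coordinates get images on a common line. *)
have [[_ h1] _] := h x y0 x y nx m0 nx ny.
have [e|e] : E (X x y0) (X x y) \/ E (Y x y0) (Y x y) by apply: h1; left.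
  have [[h2 _] _] := h x' y0 x y nx' m0 nx ny.
  have [] : E x' x \/ E y0 y; last by [].
    by apply: h2; left; apply: Et e; exact: Et (step1 _ nx') (Es (step1 _ nx)).
  by move=> /Es.
have [[h2 _] _] := h x y0 x' y nx m0 nx' ny.
by have [] : E x x' \/ E y0 y by apply: h2; right; exact: Et e eY.
Qed.

End Rook.

(** * Vectors up to nonzero scalars *)

Section Rays.
Variables (R : realType) (n : nat).
Local Notation C := R[i].
Implicit Types (x y z u v : 'cV[C]_n).

Definition par x y : Prop := exists2 a : C, a != 0 & y = a *: x.

Lemma par_refl x : par x x.
Proof. by exists 1; rewrite ?oner_eq0 ?scale1r. Qed.

Lemma par_sym x y : par x y -> par y x.
Proof.
move=> [a a0 ->]; exists a^-1; first by rewrite invr_eq0.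
by rewrite scalerA mulVf // scale1r.
Qed.

Lemma par_trans y x z : par x y -> par y z -> par x z.
Proof.
move=> [a a0 ->] [b b0 ->]; exists (b * a); first by rewrite mulf_neq0.
by rewrite scalerA.
Qed.

Lemma par_scale (a : C) x y : y != 0 -> y = a *: x -> par x y.
Proof. by move=> y0 e; have [a0 _] := neq0_scaler y0 e; exists a. Qed.

(** The component [t] of [v] orthogonal to [y] is also orthogonal to [v], hence to itself. *)
Lemma orth_par y v : v != 0 -> (forall t, ip y t = 0 -> ip v t = 0) -> par y v.
Proof.
move=> v0 h; have [y0|y0] := eqVneq y 0.
  have := h v; rewrite y0 ip0l => /(_ erefl) /eqP.
  by rewrite ip_eq0 (negPf v0).
apply: (par_scale (a := ip y v / ip y y)) => //.
set t := v - (ip y v / ip y y) *: y.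
have yt : ip y t = 0 by rewrite ipBr ipZr divfK ?subrr // ip_eq0.
have : ip t t = 0 by rewrite {1}/t ipDl (h t yt) ipNl ipZl yt mulr0 oppr0 addr0.
by move/eqP; rewrite ip_eq0 subr_eq0 => /eqP.
Qed.

Lemma par_ip_eq0 x y z : par x y -> (ip x z = 0) <-> (ip y z = 0).
Proof.
move=> [a a0 ->]; rewrite ipZl; split=> [->|/eqP]; first by rewrite mulr0.
by rewrite mulf_eq0 conjc_eq0 (negPf a0) /= => /eqP.
Qed.

Lemma par_add x y : x != 0 -> y != 0 -> ~ par x y ->
  [/\ x + y != 0, ~ par (x + y) x & ~ par (x + y) y].
Proof.
move=> x0 y0 nxy; have npar (a b : C) : b != 0 -> b *: y = a *: x -> False.
  move=> b0 e; apply: nxy; apply: (par_scale (a := b^-1 * a)) => //.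
  by rewrite -scalerA -e scalerA mulVf // scale1r.
split.
- apply/negP; rewrite addrC addr_eq0 => /eqP e; apply: (npar (-1) 1).
    exact: oner_neq0.
  by rewrite scale1r scaleN1r.
- move=> [a a0 e]; apply: (npar (1 - a) a) => //.
  by rewrite scalerBl scale1r [X in X - _]e scalerDr addrAC subrr add0r.
move=> [a a0 e]; have ea : (1 - a) *: y = a *: x.
  by rewrite scalerBl scale1r [X in X - _]e scalerDr addrK.
have [a1|a1] := eqVneq (1 - a) 0; last exact: npar a1 ea.
by move/esym/eqP: ea; rewrite a1 scale0r scaler_eq0 (negPf a0) (negPf x0).
Qed.

End Rays.

(** * Rank-one matrices under Birkhoff-James isomorphisms *)

Local Opaque BJorth.

Section Preservation.
Variables (R : realType) (n : nat).
Hypothesis n0 : (0 < n)%N.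
Local Notation C := R[i].
Implicit Types (A B D E : 'M[C]_n) (x y z u v : 'cV[C]_n).

Definition isrk1 A : Prop := exists y x, [/\ y != 0, x != 0 & A = rk1 y x].

Definition BJsub A B : Prop := forall D, BJorth A D -> BJorth B D.

Lemma rk1_neq0 y x : y != 0 -> x != 0 -> rk1 y x != 0.
Proof.
move=> y0 x0; apply/eqP => h; have := rk1_mul y x x; rewrite h mul0mx => /esym/eqP.
by rewrite scaler_eq0 ip_eq0 (negPf x0) (negPf y0).
Qed.

(** Describes rank one by orthogonality alone, so that a Birkhoff-James isomorphism must preserve
    it. *)
Lemma isrk1P A : isrk1 A <-> A <> 0 /\ forall B, nonsmooth B -> BJorth B A.
Proof.
split=> [[y [x [y0 x0 ->]]]|[A0 /(rk1P n0) [y [x E]]]].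
  by split=> [|B]; [exact/eqP/rk1_neq0|exact: rk1_nonsmooth].
exists y, x; rewrite E; split => //; apply/eqP => h; apply: A0; rewrite E h /rk1.
  by rewrite mul0mx.
by rewrite ctr0 mulmx0.
Qed.

Lemma rk1_sub x1 y1 x2 y2 : x1 != 0 -> y1 != 0 -> x2 != 0 -> y2 != 0 ->
  BJsub (rk1 y1 x1) (rk1 y2 x2) <-> par x1 x2 /\ par y1 y2.
Proof.
move=> x10 y10 x20 y20; rewrite /BJsub (rk1_BJorth_sub n0 (rk1_neq0 y20 x20) x10 y10).
split=> [[/(attains_rk1 n0 x20 y20) [a x1a] [c]]|[[a a0 ->] [b b0 ->]]].
  rewrite rk1_mul => y1c; split; apply: par_sym; first exact: (par_scale x10 x1a).
  by apply: (par_scale (a := c * ip x2 x1) y10); rewrite y1c scalerA.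
split.
  have := attainsZ a^-1 (attains_rk1_self n0 (b *: y1) (a *: x1)).
  by rewrite scalerA mulVf // scale1r.
exists ((b * ip (a *: x1) x1)^-1); rewrite rk1_mul !scalerA -mulrA [_ * b]mulrC mulVf ?scale1r //.
by rewrite mulf_neq0 // ipZl mulf_neq0 ?conjc_eq0 // ip_eq0.
Qed.

Lemma BJorth_rk1_rk1 x y u v : x != 0 -> y != 0 ->
  BJorth (rk1 y x) (rk1 v u) <-> ip y v = 0 \/ ip u x = 0.
Proof.
move=> x0 y0; rewrite (BJorth_rk1 n0) // rk1_mul ipZr; split=> [/eqP|[] ->].
- by rewrite mulf_eq0 => /orP[] /eqP; [right|left].
- by rewrite mulr0.
by rewrite mul0r.
Qed.

(* For rank-one matrices this says that [A] and [B] share a row or a column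
   direction: only then does their span contain further rank-one matrices [E]. *)
Definition madj A B : Prop := BJsub A B \/
  exists E, [/\ isrk1 E, ~ BJsub A E, ~ BJsub B E &
    forall D, isrk1 D -> BJorth D A -> BJorth D B -> BJorth D E].

Lemma madj_rk1 x1 y1 x2 y2 : x1 != 0 -> y1 != 0 -> x2 != 0 -> y2 != 0 ->
  madj (rk1 y1 x1) (rk1 y2 x2) <-> par x1 x2 \/ par y1 y2.
Proof.
move=> x10 y10 x20 y20; split.
  move=> [/rk1_sub [] //|]; first by left.
  move=> [_ [[v [u [v0 u0 ->]]] /rk1_sub n1 /rk1_sub n2 h]].
  apply: contrapT => /not_orP [nx ny].
  (* The test matrix [rk1 t s] is orthogonal to both given matrices when [t] is orthogonal to the
     column vector of one and [s] to the row vector of the other. *)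
  have key t s (y x : 'cV[C]_n) : ((y = y2 /\ x = x1) \/ (y = y1 /\ x = x2)) ->
      ip y t = 0 -> ip x s = 0 -> ip t v = 0 \/ ip u s = 0.
    move=> yx yt xs; have [->|t0] := eqVneq t 0; first by left; rewrite ip0l.
    have [->|s0] := eqVneq s 0; first by right; rewrite ip0r.
    apply/(BJorth_rk1_rk1 _ _ s0 t0); apply: h; first by exists t, s.
      rewrite BJorth_rk1_rk1 //; case: yx => -[ye xe]; first by right; rewrite -xe.
      by left; apply/ip_eq0C; rewrite -ye.
    rewrite BJorth_rk1_rk1 //; case: yx => -[ye xe]; last by right; rewrite -xe.
    by left; apply/ip_eq0C; rewrite -ye.
  have alt y x : ((y = y2 /\ x = x1) \/ (y = y1 /\ x = x2)) -> par y v \/ par x u.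
    move=> yx; apply: contrapT => /not_orP [nyv nxu].
    have [t [yt vt]] : exists t, ip y t = 0 /\ ip v t <> 0.
      apply: contrapT => hn; apply: nyv; apply: orth_par => // t yt.
      by apply: contrapT => vt; apply: hn; exists t.
    have [s [xs us]] : exists s, ip x s = 0 /\ ip u s <> 0.
      apply: contrapT => hn; apply: nxu; apply: orth_par => // s xs.
      by apply: contrapT => us; apply: hn; exists s.
    by have [/ip_eq0C //|] := key t s y x yx yt xs.
  (* Each of the four combinations makes [E] proportional to a given matrix or makes these two share
     a direction. *)
  have [a|a] := alt y2 x1 (or_introl (conj erefl erefl));
  have [b|b] := alt y1 x2 (or_intror (conj erefl erefl)).
  - by apply: ny; apply: par_trans b (par_sym a).
  - by apply: n2.
  - by apply: n1.
  by apply: nx; apply: par_trans a (par_sym b).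
have [px|nx] := pselect (par x1 x2); have [py|ny] := pselect (par y1 y2).
- by move=> _; left; apply/rk1_sub.
- move=> _; right; have [s0 s1 s2] := par_add y10 y20 ny.
  exists (rk1 (y1 + y2) x1); split; first by exists (y1 + y2), x1.
  - by move=> /rk1_sub [] // _ /par_sym.
  - by move=> /rk1_sub [] // _ /par_sym.
  move=> _ [t [s [t0 s0' ->]]]; rewrite !BJorth_rk1_rk1 // => -[h1|]; last by right.
  move=> [h2|]; first by left; rewrite ipDr h1 h2 addr0.
  by move=> /(par_ip_eq0 _ px); right.
- move=> _; right; have [s0 s1 s2] := par_add x10 x20 nx.
  exists (rk1 y1 (x1 + x2)); split; first by exists y1, (x1 + x2).
  - by move=> /rk1_sub [] // /par_sym.
  - by move=> /rk1_sub [] // /par_sym.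
  move=> _ [t [s [t0 s0' ->]]]; rewrite !BJorth_rk1_rk1 // => -[|h1]; first by left.
  move=> [|h2]; last by right; rewrite ipDl h1 h2 addr0.
  by move=> /ip_eq0C /(par_ip_eq0 _ py) /ip_eq0C; left.
by move=> [].
Qed.

Section Iso.
Variables (Phi Psi : 'M[C]_n -> 'M[C]_n).
Hypotheses (PhiK : cancel Phi Psi) (PsiK : cancel Psi Phi).
Hypothesis BJ : forall A B, BJorth A B <-> BJorth (Phi A) (Phi B).

Lemma BJ_inv A B : BJorth A B <-> BJorth (Psi A) (Psi B).
Proof. by have := BJ (Psi A) (Psi B); rewrite !PsiK => h; exact: iff_sym h. Qed.

Lemma BJsub_iso A B : BJsub A B <-> BJsub (Phi A) (Phi B).
Proof.
split=> h D hD; last by exact: (BJ B D).2 (h _ ((BJ A D).1 hD)).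
rewrite -(PsiK D) in hD *.
have h1 := (BJ A (Psi D)).2 hD.
exact: (BJ B (Psi D)).1 (h _ h1).
Qed.

Lemma Phi_eq0 A : Phi A = 0 <-> A = 0.
Proof.
have h := BJ A A; have hA := BJorth_self n0 A; have hP := BJorth_self n0 (Phi A).
by split=> e; [exact: hA.1 (h.2 (hP.2 e))|exact: hP.1 (h.1 (hA.2 e))].
Qed.

Lemma nonsmooth_iso A : nonsmooth A -> nonsmooth (Phi A).
Proof.
move=> [B [B0 BA nAB]]; exists (Phi B); split.
- by apply/eqP => e; have := (Phi_eq0 B).1 e; apply/eqP.
- exact: (BJsub_iso B A).1 BA.
by move=> h; apply: nAB; exact: (BJsub_iso A B).2 h.
Qed.

End Iso.

Lemma isrk1_iso (Phi Psi : 'M[C]_n -> 'M[C]_n) :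
  cancel Phi Psi -> cancel Psi Phi ->
  (forall A B, BJorth A B <-> BJorth (Phi A) (Phi B)) ->
  forall A, isrk1 A -> isrk1 (Phi A).
Proof.
move=> PhiK PsiK BJ A rA; have [A0 hA] := (isrk1P A).1 rA.
apply: (isrk1P _).2; split=> [e|B nsB]; first exact: A0 ((Phi_eq0 BJ A).1 e).
have BJ' := BJ_inv PsiK BJ.
have nsP := @nonsmooth_iso Psi Phi PhiK BJ' B nsB.
by have := (BJ (Psi B) A).1 (hA _ nsP); rewrite PsiK.
Qed.

Lemma madj_iso (Phi Psi : 'M[C]_n -> 'M[C]_n) :
  cancel Phi Psi -> cancel Psi Phi ->
  (forall A B, BJorth A B <-> BJorth (Phi A) (Phi B)) ->
  forall A B, madj A B -> madj (Phi A) (Phi B).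
Proof.
move=> PhiK PsiK BJ A B [h|[E [rE nA nB h]]].
  by left; exact: (BJsub_iso PsiK BJ A B).1 h.
right; exists (Phi E); split; first exact: (@isrk1_iso Phi Psi PhiK PsiK BJ E rE).
- by move=> e; exact: nA ((BJsub_iso PsiK BJ A E).2 e).
- by move=> e; exact: nB ((BJsub_iso PsiK BJ B E).2 e).
move=> D rD DA DB.
have BJ' := BJ_inv PsiK BJ.
have rP := @isrk1_iso Psi Phi PsiK PhiK BJ' D rD.
rewrite -(PsiK D) in DA; rewrite -(PsiK D) in DB.
have := (BJ (Psi D) E).1 (h _ rP ((BJ (Psi D) A).2 DA) ((BJ (Psi D) B).2 DB)).
by rewrite PsiK.
Qed.

End Preservation.

(** * The induced maps on row and column directions *)

Section RankOneMap.
Variables (R : realType) (n : nat).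
Hypothesis n2 : (1 < n)%N.
Local Notation C := R[i].
Variables (Phi Psi : 'M[C]_n -> 'M[C]_n).
Hypotheses (PhiK : cancel Phi Psi) (PsiK : cancel Psi Phi).
Hypothesis BJ : forall A B, BJorth A B <-> BJorth (Phi A) (Phi B).
Implicit Types (x y z u v : 'cV[C]_n).

Let n0 : (0 < n)%N := ltnW n2.

Lemma not_par_exists x : x != 0 -> exists2 y, y != 0 & ~ par x y.
Proof.
move=> x0; pose d (k : 'I_n) : 'cV[C]_n := delta_mx k 0.
pose i0 := Ordinal n0; pose i1 := Ordinal n2.
have d0 k : d k != 0.
  by apply/eqP => /matrixP /(_ k 0) /eqP; rewrite !mxE !eqxx oner_eq0.
have [p|] := pselect (par x (d i0)); last by exists (d i0).
exists (d i1) => // p1; have [a a0] := par_trans (par_sym p) p1.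
by move=> /matrixP /(_ i1 0) /eqP; rewrite !mxE !eqxx /= mulr0 oner_eq0.
Qed.

Lemma rk1_map : exists X Y : 'cV[C]_n -> 'cV[C]_n -> 'cV[C]_n,
  forall x y, x != 0 -> y != 0 ->
  [/\ X x y != 0, Y x y != 0 & Phi (rk1 y x) = rk1 (Y x y) (X x y)].
Proof.
have h (p : 'cV[C]_n * 'cV[C]_n) : exists q : 'cV[C]_n * 'cV[C]_n,
    p.1 != 0 -> p.2 != 0 ->
    [/\ q.1 != 0, q.2 != 0 & Phi (rk1 p.2 p.1) = rk1 q.2 q.1].
  (* A pair with a zero component carries no condition; the pair itself is the default value. *)
  have [p0|p0] := pselect (p.1 != 0 /\ p.2 != 0); last first.
    by exists p => h1 h2; case: p0.
  have rp : isrk1 (rk1 p.2 p.1) by exists p.2, p.1; case: p0.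
  have [y [x [y0 x0 e]]] := @isrk1_iso R n n0 Phi Psi PhiK PsiK BJ _ rp.
  by exists (x, y).
have [f hf] := choice h.
by exists (fun x y => (f (x, y)).1), (fun x y => (f (x, y)).2) => x y; exact: (hf (x, y)).
Qed.

Lemma rk1_map_rook X Y : (forall x y, x != 0 -> y != 0 ->
  [/\ X x y != 0, Y x y != 0 & Phi (rk1 y x) = rk1 (Y x y) (X x y)]) ->
  rook_morphism (fun x => x != 0) (@par R n) X Y.
Proof.
move=> h x1 y1 x2 y2 x10 y10 x20 y20.
have [X10 Y10 E1] := h x1 y1 x10 y10; have [X20 Y20 E2] := h x2 y2 x20 y20.
split.
  have a1 := madj_rk1 n0 X10 Y10 X20 Y20; have a2 := madj_rk1 n0 x10 y10 x20 y20.
  rewrite -E1 -E2 in a1; split=> e; [apply: a2.1|apply: a1.1].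
    have BJ' := BJ_inv PsiK BJ.
    have := @madj_iso R n n0 Psi Phi PsiK PhiK BJ' _ _ (a1.2 e).
    by rewrite !PhiK.
  exact: (@madj_iso R n n0 Phi Psi PhiK PsiK BJ _ _ (a2.2 e)).
have a1 := rk1_sub n0 X10 Y10 X20 Y20; have a2 := rk1_sub n0 x10 y10 x20 y20.
have a3 := @BJsub_iso R n Phi Psi PsiK BJ (rk1 y1 x1) (rk1 y2 x2).
rewrite E1 E2 in a3.
by split=> e; [exact: a2.1 (a3.2 (a1.2 e))|exact: a1.1 (a3.1 (a2.2 e))].
Qed.

(** By the dichotomy each component of the image depends, up to scalars, on one argument only, so
    the other is frozen at a fixed [e]. *)
Lemma rk1_map_split :
  (exists f g : 'cV[C]_n -> 'cV[C]_n, forall x y, x != 0 -> y != 0 ->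
    [/\ f x != 0, g y != 0 & exists2 c, c != 0 & Phi (rk1 y x) = c *: rk1 (g y) (f x)]) \/
  (exists f g : 'cV[C]_n -> 'cV[C]_n, forall x y, x != 0 -> y != 0 ->
    [/\ f x != 0, g y != 0 & exists2 c, c != 0 & Phi (rk1 y x) = c *: rk1 (f x) (g y)]).
Proof.
have [X [Y h]] := rk1_map; have rook := rk1_map_rook h.
pose e : 'cV[C]_n := delta_mx (Ordinal n0) 0.
have e0 : e != 0 by apply/eqP => /matrixP /(_ (Ordinal n0) 0) /eqP; rewrite !mxE !eqxx oner_eq0.
have [[hY hX]|[hX hY]] := rook_dichotomy (@par_refl R n) (@par_sym R n)
    (@par_trans R n) not_par_exists rook; [left|right].
  exists (fun x => X x e), (fun y => Y e y) => x y x0 y0.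
  have [X0 _ _] := h x e x0 e0; have [_ Y0 _] := h e y e0 y0; split=> //.
  have [_ _ ->] := h x y x0 y0.
  have [a a0 ->] := hX x e y x0 e0 y0; have [b b0 ->] := hY e x y e0 x0 y0.
  by exists (conjc a * b); rewrite ?mulf_neq0 ?conjc_eq0 // rk1Zr rk1Zl scalerA.
exists (fun x => Y x e), (fun y => X e y) => x y x0 y0.
have [_ Y0 _] := h x e x0 e0; have [X0 _ _] := h e y e0 y0; split=> //.
have [_ _ ->] := h x y x0 y0.
have [a a0 ->] := hX e x y e0 x0 y0; have [b b0 ->] := hY x e y x0 e0 y0.
by exists (conjc a * b); rewrite ?mulf_neq0 ?conjc_eq0 // rk1Zr rk1Zl scalerA.
Qed.

End RankOneMap.

(** * Ray maps intertwining all matrices *)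

Section Intertwine.
Variables (R : realType) (n : nat).
Local Notation C := R[i].
Local Notation V := 'cV[C]_n.
Variables (h : V -> V) (Q : 'M[C]_n -> 'M[C]_n).
Hypothesis h0 : forall x, x != 0 -> h x != 0.
Hypothesis h_surj : forall z, z != 0 -> exists2 x, x != 0 & par (h x) z.
Hypothesis hQ : forall B x y, x != 0 -> y != 0 ->
  ip y (B *m x) = 0 <-> ip (h y) (Q B *m h x) = 0.
Hypothesis h_orth : forall x y, x != 0 -> y != 0 -> ip y x = 0 <-> ip (h y) (h x) = 0.
Implicit Types (x y z u v : V) (B : 'M[C]_n).

Lemma ip_surj v : (forall y, y != 0 -> ip (h y) v = 0) -> v = 0.
Proof.
move=> hv; apply/eqP; apply/negPn/negP => v0.
have [x x0 [a a0 e]] := h_surj v0.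
have : ip v v = 0 by rewrite {1}e ipZl hv // mulr0.
by move/eqP; rewrite ip_eq0 (negPf v0).
Qed.

Lemma intertwine0 B x : x != 0 -> B *m x = 0 -> Q B *m h x = 0.
Proof.
move=> x0 Bx; apply: ip_surj => y y0; apply: (hQ B x0 y0).1.
by rewrite Bx ip0r.
Qed.

(** A nonzero vector orthogonal to [h (B *m x)] is a multiple of some [h s] with [s] orthogonal to
    [B *m x], and [hQ] makes it orthogonal to [Q B *m h x]. *)
Lemma intertwine B x : B *m x != 0 -> par (h (B *m x)) (Q B *m h x).
Proof.
move=> Bx0.
have x0 : x != 0 by apply: contra_neq Bx0 => ->; rewrite mulmx0.
apply: orth_par => [|t].
  apply/eqP => e; have := (hQ B x0 Bx0).2; rewrite e ip0r => /(_ erefl)/eqP.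
  by rewrite ip_eq0 (negPf Bx0).
have [->|t0] := eqVneq t 0; first by rewrite !ip0r.
have [s s0 [a a0 ->]] := h_surj t0; rewrite !ipZr => /eqP.
rewrite mulf_eq0 (negPf a0) /= => /eqP /(h_orth s0 Bx0).2 /ip_eq0C e.
by rewrite ((ip_eq0C _ _).1 ((hQ B x0 s0).1 e)) mulr0.
Qed.

Lemma par_map x y : x != 0 -> par x y -> par (h x) (h y).
Proof.
move=> x0 [a a0 ->]; have y0 : a *: x != 0 by rewrite scaler_eq0 negb_or a0 x0.
apply: orth_par => [|t]; first exact: h0.
have [->|t0] := eqVneq t 0; first by rewrite !ip0r.
have [s s0 [b b0 ->]] := h_surj t0; rewrite !ipZr => /eqP.
rewrite mulf_eq0 (negPf b0) /= => /eqP /(h_orth s0 x0).2 e.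
have e' : ip (a *: x) s = 0 by rewrite ipZl e mulr0.
by rewrite ((h_orth s0 y0).1 e') mulr0.
Qed.

Section Frame.
Local Notation e k := (delta_mx k 0 : V).
Local Notation one := (const_mx 1 : V).

Lemma ip_delta k x : ip (e k) x = x k 0.
Proof.
by rewrite /ip /ctr trmx_delta map_delta_mx -rowE mxE.
Qed.

Lemma delta_neq0 k : e k != 0.
Proof. by rewrite -ip_eq0 ip_delta mxE !eqxx oner_eq0. Qed.

Lemma cV_sum x : x = \sum_k x k 0 *: e k.
Proof.
apply/matrixP => i j; rewrite ord1 summxE (bigD1 i) //= big1 => [|k ki]; rewrite !mxE.
  by rewrite !eqxx mulr1 addr0.
by rewrite eq_sym (negPf ki) mulr0.
Qed.

Hypothesis he : forall k, par (h (e k)) (e k).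
Hypothesis hone : par (h one) one.

Lemma coord_eq0 x k : x != 0 -> (x k 0 = 0) <-> (h x k 0 = 0).
Proof.
move=> x0; rewrite -!ip_delta; apply: iff_trans (h_orth x0 (delta_neq0 k)) _.
exact: par_ip_eq0.
Qed.

Lemma par_coord x y k l : par x y -> y l 0 * x k 0 = x l 0 * y k 0.
Proof. by move=> [a _ ->]; rewrite !mxE; ring. Qed.

Variables i0 i1 : 'I_n.
Hypothesis i01 : i0 != i1.

Definition pair_vec (a b : C) : V := a *: e i0 + b *: e i1.

Lemma pair_vec0 a b : pair_vec a b i0 0 = a.
Proof. by rewrite !mxE !eqxx (negPf i01) /= mulr1 mulr0 addr0. Qed.

Lemma pair_vec1 a b : pair_vec a b i1 0 = b.
Proof. by rewrite !mxE !eqxx eq_sym (negPf i01) /= mulr1 mulr0 add0r. Qed.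

Lemma pair_vecN a b k : k != i0 -> k != i1 -> pair_vec a b k 0 = 0.
Proof. by move=> k0 k1; rewrite !mxE (negPf k0) (negPf k1) /= !mulr0 addr0. Qed.

Lemma pair_vecP v : (forall k, k != i0 -> k != i1 -> v k 0 = 0) ->
  v = pair_vec (v i0 0) (v i1 0).
Proof.
move=> hv; apply/matrixP => k j; rewrite ord1.
have [->|k0] := eqVneq k i0; first by rewrite pair_vec0.
have [->|k1] := eqVneq k i1; first by rewrite pair_vec1.
by rewrite pair_vecN // hv.
Qed.

Lemma pair_vec_neq0l a b : a != 0 -> pair_vec a b != 0.
Proof. by apply: contra_neq => e0; rewrite -(pair_vec0 a b) e0 mxE. Qed.

Lemma h_pair_vec a b : pair_vec a b != 0 ->
  h (pair_vec a b) = pair_vec (h (pair_vec a b) i0 0) (h (pair_vec a b) i1 0).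
Proof.
move=> p0; apply: pair_vecP => k k0 k1; apply: (coord_eq0 k p0).1.
exact: pair_vecN.
Qed.

(** The vector with entries 1 and -1 is orthogonal to [one], whose ray [h] fixes. The vector with
    entries 1 and 1 is treated next through its orthogonality to this one. *)
Lemma h_pair_diff : h (pair_vec 1 (-1)) i1 0 = - h (pair_vec 1 (-1)) i0 0.
Proof.
have p0 : pair_vec 1 (-1) != 0 by rewrite pair_vec_neq0l // oner_neq0.
have one0 : one != 0.
  by apply/eqP => /matrixP /(_ i0 0) /eqP; rewrite !mxE oner_eq0.
have E (a b : C) : ip one (pair_vec a b) = a + b.
  rewrite ipE (bigD1 i0) //= (bigD1 i1) 1?eq_sym //= big1.
    by rewrite pair_vec0 pair_vec1 !mxE conjc1 !mul1r addr0.
  by move=> k /andP[k0 k1]; rewrite pair_vecN // mulr0.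
have : ip one (h (pair_vec 1 (-1))) = 0.
  apply: (par_ip_eq0 _ hone).1; apply: (h_orth p0 one0).1.
  by rewrite E subrr.
by rewrite (h_pair_vec p0) E !(pair_vec0, pair_vec1) => /eqP; rewrite addrC addr_eq0 => /eqP.
Qed.

Lemma h_pair_sum : h (pair_vec 1 1) i1 0 = h (pair_vec 1 1) i0 0.
Proof.
have p0 : pair_vec 1 (-1) != 0 by rewrite pair_vec_neq0l // oner_neq0.
have q0 : pair_vec 1 1 != 0 by rewrite pair_vec_neq0l // oner_neq0.
have E (a b c d : C) : ip (pair_vec a b) (pair_vec c d) = conjc a * c + conjc b * d.
  by rewrite ipDl !ipZl !ip_delta pair_vec0 pair_vec1.
have : ip (h (pair_vec 1 (-1))) (h (pair_vec 1 1)) = 0.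
  apply: (h_orth q0 p0).1.
  by rewrite E !mulr1 rmorphN subrr.
have [a a0 ea] : exists2 a, a != 0 & h (pair_vec 1 (-1)) = pair_vec a (- a).
  exists (h (pair_vec 1 (-1)) i0 0); last by rewrite -h_pair_diff; exact: h_pair_vec.
  by apply/eqP => /(coord_eq0 _ p0) /eqP; rewrite pair_vec0 oner_eq0.
rewrite ea (h_pair_vec q0) E rmorphN mulNr -mulrBr pair_vec0 pair_vec1 => /eqP.
by rewrite mulf_eq0 conjc_eq0 (negPf a0) subr_eq0 => /eqP.
Qed.

Definition two_col (i j : 'I_n) u v : 'M[C]_n := rk1 u (e i) + rk1 v (e j).

Lemma two_col_mul i j u v x : two_col i j u v *m x = x i 0 *: u + x j 0 *: v.
Proof. by rewrite mulmxDl !rk1_mul !ip_delta. Qed.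

(** Because [h] fixes the coordinate rays, each column of [Q B] is proportional to [h] of that
    column of [B], and zero columns stay zero. *)
Lemma Q_two_col i j u v : i != j -> u != 0 -> v != 0 ->
  exists a b, [/\ a != 0, b != 0 & forall x,
    Q (two_col i j u v) *m x = x i 0 *: (a *: h u) + x j 0 *: (b *: h v)].
Proof.
move=> ij u0 v0; set B := two_col i j u v.
have col k w : B *m e k = w -> w != 0 -> exists2 a, a != 0 & Q B *m e k = a *: h w.
  move=> <- w0; have [a a0 ea] := intertwine w0; have [b b0 eb] := he k.
  exists (b * a); first by rewrite mulf_neq0.
  by rewrite {1}eb -scalemxAr ea scalerA.
have [a a0 ea] : exists2 a, a != 0 & Q B *m e i = a *: h u.
  by apply: col; rewrite // two_col_mul !mxE !eqxx eq_sym (negPf ij) scale1r scale0r addr0.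
have [b b0 eb] : exists2 a, a != 0 & Q B *m e j = a *: h v.
  by apply: col; rewrite // two_col_mul !mxE !eqxx (negPf ij) scale1r scale0r add0r.
exists a, b; split=> // x; rewrite {1}(cV_sum x) mulmx_sumr (bigD1 i) //= (bigD1 j) 1?eq_sym //=.
rewrite -!scalemxAr ea eb big1 ?addr0 // => k /andP[ki kj]; rewrite -scalemxAr.
have [c c0 ->] := he k; rewrite -scalemxAr intertwine0 ?scaler0 ?delta_neq0 //.
by rewrite two_col_mul !mxE !(eq_sym _ k) (negPf ki) (negPf kj) !scale0r addr0.
Qed.

(* Any two coordinates of [h x] depend only on those of [x]. *)
Lemma h_coords i j x : i != j -> x i 0 != 0 ->
  par (h (pair_vec (x i 0) (x j 0))) (pair_vec (h x i 0) (h x j 0)).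
Proof.
move=> ij xi0.
have [a [b [a0 b0 QB]]] := Q_two_col ij (delta_neq0 i0) (delta_neq0 i1).
set B := two_col _ _ _ _ in QB.
have [c c0 ec] := par_sym (he i0); have [d d0 ed] := par_sym (he i1).
have {}QB y : Q B *m y = pair_vec (y i 0 * (a * c)) (y j 0 * (b * d)).
  by rewrite QB ec ed /pair_vec !scalerA !mulrA.
have BE y : B *m y = pair_vec (y i 0) (y j 0) by rewrite two_col_mul.
have key y : pair_vec (y i 0) (y j 0) != 0 ->
    par (h (pair_vec (y i 0) (y j 0))) (pair_vec (h y i 0 * (a * c)) (h y j 0 * (b * d))).
  by move=> y0; have := @intertwine B y; rewrite QB BE => /(_ y0).
(* Both factors agree because [h] fixes the ray of [one] and, by [h_pair_sum], that of
   [pair_vec 1 1]. *)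
have abcd : a * c = b * d.
  have := key one; rewrite !mxE => /(_ (pair_vec_neq0l _ (oner_neq0 _))).
  move=> /(par_coord i0 i1); rewrite h_pair_sum !pair_vec0 !pair_vec1.
  have [l l0 el] := par_sym hone; rewrite el !mxE !mulr1 => /esym.
  rewrite mulrC => /mulIf.
  have q0 : pair_vec 1 1 != 0 by rewrite pair_vec_neq0l // oner_neq0.
  have -> : h (pair_vec 1 1) i0 0 != 0.
    by apply/eqP => /(coord_eq0 _ q0) /eqP; rewrite pair_vec0 oner_eq0.
  by move=> /(_ isT) /(mulfI l0).
apply: par_trans (key x (pair_vec_neq0l _ xi0)) _; apply: par_sym.
exists (a * c); first by rewrite mulf_neq0.
by rewrite -abcd /pair_vec scalerDr !scalerA ![_ * (a * c)]mulrC.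
Qed.

(** The action of [h] on slopes in one coordinate plane; this becomes the field endomorphism. *)
Definition sg (t : C) : C := h (pair_vec 1 t) i1 0 / h (pair_vec 1 t) i0 0.

Lemma pair_vec1_neq0 t : pair_vec 1 t != 0.
Proof. by rewrite pair_vec_neq0l // oner_neq0. Qed.

Lemma h_pair0_neq0 t : h (pair_vec 1 t) i0 0 != 0.
Proof.
apply/eqP => /(coord_eq0 _ (pair_vec1_neq0 t)) /eqP.
by rewrite pair_vec0 oner_eq0.
Qed.

Lemma h_pair_sg t : h (pair_vec 1 t) = h (pair_vec 1 t) i0 0 *: pair_vec 1 (sg t).
Proof.
rewrite {1}(h_pair_vec (pair_vec1_neq0 t)) /pair_vec scalerDr !scalerA mulr1.
by rewrite -/(pair_vec 1 t) /sg mulrC divfK // h_pair0_neq0.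
Qed.

Lemma sg_eq t w : par (h (pair_vec 1 t)) w -> w i1 0 = sg t * w i0 0.
Proof.
move=> /(par_coord i0 i1); rewrite /sg => ew.
by rewrite mulrAC -ew mulfK // h_pair0_neq0.
Qed.

Lemma sg0 : sg 0 = 0.
Proof.
rewrite /sg (coord_eq0 i1 (pair_vec1_neq0 0)).1 ?mul0r //.
exact: pair_vec1.
Qed.

Lemma sg1 : sg 1 = 1.
Proof. by rewrite /sg h_pair_sum divff // h_pair0_neq0. Qed.

(** The vector [u + t *: v] is the image of [pair_vec 1 t] under one matrix, so [a] and [b] do not
    depend on [t]. *)
Lemma h_add_scale u v : u != 0 -> v != 0 -> exists a b, [/\ a != 0, b != 0 &
  forall t, u + t *: v != 0 -> par (h (u + t *: v)) (a *: h u + (sg t * b) *: h v)].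
Proof.
move=> u0 v0; have [a [b [a0 b0 QB]]] := Q_two_col i01 u0 v0.
exists a, b; split=> // t; set B := two_col _ _ _ _ in QB.
have <- : B *m pair_vec 1 t = u + t *: v.
  by rewrite two_col_mul pair_vec0 pair_vec1 scale1r.
move=> w0; apply: par_trans (intertwine w0) _; apply: par_sym.
exists (h (pair_vec 1 t) i0 0); first exact: h_pair0_neq0.
rewrite QB h_pair_sg; move: (h (pair_vec 1 t) i0 0) => c.
have scE (w : V) k : (c *: w) k 0 = c * w k 0 by rewrite mxE.
rewrite !scE pair_vec0 pair_vec1 mulr1.
by rewrite scalerDr !scalerA !mulrA.
Qed.

(** Moving from [e i0] in the direction [s *: e i1] shows that [sg (r * s)] is a constant multiple
    of [sg r], and [r = 1] gives the constant. *)
Lemma sgM s t : sg (t * s) = sg t * sg s.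
Proof.
have [->|s0] := eqVneq s 0; first by rewrite mulr0 sg0 mulr0.
have v0 : s *: e i1 != 0 by rewrite scaler_eq0 negb_or s0 delta_neq0.
have [a [b [a0 b0 H]]] := h_add_scale (delta_neq0 i0) v0.
have [c c0 ec] := par_sym (he i0).
have [d d0 ed] : par (e i1) (h (s *: e i1)).
  apply: par_trans (par_sym (he i1)) (par_map (delta_neq0 i1) _).
  by exists s.
have key r : sg (r * s) * (a * c) = sg r * (b * d).
  have E : e i0 + r *: (s *: e i1) = pair_vec 1 (r * s).
    by rewrite /pair_vec scale1r scalerA.
  have := H r; rewrite E => /(_ (pair_vec1_neq0 _)).
  rewrite ec ed !scalerA -/(pair_vec _ _) => /sg_eq.
  by rewrite pair_vec0 pair_vec1 => <-; rewrite mulrA.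
have ac0 : a * c != 0 by rewrite mulf_neq0.
have := key 1; rewrite mul1r sg1 mul1r => e1.
by apply: (mulIf ac0); rewrite key -e1 mulrA.
Qed.

Lemma sgN1 : sg (-1) = -1.
Proof. by rewrite /sg h_pair_diff mulNr divff // h_pair0_neq0. Qed.

Lemma sgD s t : sg (s + t) = sg s + sg t.
Proof.
have [->|s0] := eqVneq s 0; first by rewrite sg0 !add0r.
have [a [b [a0 b0 H]]] := h_add_scale (pair_vec1_neq0 s) (delta_neq0 i1).
have [d d0 ed] := par_sym (he i1); have c0 := h_pair0_neq0 s.
have ec := h_pair_sg s; move: (h (pair_vec 1 s) i0 0) c0 ec => c c0 ec.
have key r : sg (s + r) * (a * c) = sg s * (a * c) + sg r * (b * d).
  have E : pair_vec 1 s + r *: e i1 = pair_vec 1 (s + r).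
    by rewrite /pair_vec -addrA -scalerDl.
  have := H r; rewrite E => /(_ (pair_vec1_neq0 _)).
  have -> : a *: h (pair_vec 1 s) + (sg r * b) *: h (e i1) =
      pair_vec (a * c) (sg s * (a * c) + sg r * (b * d)).
    rewrite ec ed /pair_vec !scalerDr !scalerA -addrA -scalerDl mulr1.
    by congr (_ + _ *: _); ring.
  by move=> /sg_eq; rewrite pair_vec0 pair_vec1 => ->.
have ac0 : a * c != 0 by rewrite mulf_neq0.
have sgs : sg s != 0.
  apply/eqP => es; have := sgM s^-1 s; rewrite mulfV // sg1 es mul0r => /eqP.
  by rewrite oner_eq0.
(* The case [r = - s] of [key]: its left side vanishes, which forces [a * c = b * d]. *)
have /esym/eqP : sg (s - s) * (a * c) = sg s * (a * c - b * d).
  by rewrite key -[in sg (- s)]mulN1r sgM sgN1; ring.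
rewrite subrr sg0 mul0r mulf_eq0 (negPf sgs) subr_eq0 => /eqP acbd.
by apply: (mulIf ac0); rewrite key -acbd mulrDl.
Qed.

(** For nonzero [t], the slopes [t] and [- (conjc t)^-1] are orthogonal, and so are their images.
    Multiplicativity evaluates the second image. *)
Lemma sg_conj t : sg (conjc t) = conjc (sg t).
Proof.
have [->|t0] := eqVneq t 0; first by rewrite conjc0 sg0 conjc0.
have tc0 : conjc t != 0 by rewrite conjc_eq0.
have E (a b c d : C) : ip (pair_vec a b) (pair_vec c d) = conjc a * c + conjc b * d.
  by rewrite ipDl !ipZl !ip_delta pair_vec0 pair_vec1.
have sgV : sg (- (conjc t)^-1) * sg (conjc t) = -1.
  by rewrite -sgM mulNr mulVf // sgN1.
have : ip (h (pair_vec 1 t)) (h (pair_vec 1 (- (conjc t)^-1))) = 0.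
  apply: (h_orth (pair_vec1_neq0 _) (pair_vec1_neq0 _)).1.
  by rewrite E conjc1 mulr1 mulrN mulfV // subrr.
rewrite (h_pair_sg t); have := h_pair0_neq0 t; move: (h _ i0 0) => a a0.
rewrite (h_pair_sg (- (conjc t)^-1)); have := h_pair0_neq0 (- (conjc t)^-1).
move: (h _ i0 0) => b b0; rewrite ipZl ipZr E conjc1 mulr1 => /eqP.
rewrite !mulf_eq0 conjc_eq0 (negPf a0) (negPf b0) /= => /eqP es.
have s0 : sg (- (conjc t)^-1) != 0.
  by apply/eqP => s0; move/eqP: sgV; rewrite s0 mul0r eq_sym oppr_eq0 oner_eq0.
apply: (mulIf s0); rewrite mulrC sgV; apply/esym/eqP.
by rewrite -addr_eq0 addrC es.
Qed.

(** Dividing by a nonzero coordinate reduces every other coordinate to a slope in the plane of [i0]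
    and [i1]. *)
Lemma h_sg x : x != 0 -> par (map_mx sg x) (h x).
Proof.
move=> x0; have [i xi] : exists i, x i 0 != 0.
  apply: contrapT => hn; move/eqP: x0; apply; apply/matrixP => i j; rewrite ord1 mxE.
  by apply/eqP/negPn/negP => xi; apply: hn; exists i.
have sgi : sg (x i 0) != 0.
  apply/eqP => es; have := sgM (x i 0)^-1 (x i 0); rewrite mulfV // sg1 es mul0r.
  by move/eqP; rewrite oner_eq0.
have hi : h x i 0 != 0 by apply: contra_neq xi => /(coord_eq0 i x0).
exists (h x i 0 / sg (x i 0)); first by rewrite mulf_neq0 ?invr_eq0.
apply/matrixP => j k; rewrite ord1 !mxE.
have [<-|ij] := eqVneq i j; first by rewrite divfK.
have := h_coords ij xi.
have -> : pair_vec (x i 0) (x j 0) = x i 0 *: pair_vec 1 (x j 0 / x i 0).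
  by rewrite /pair_vec scalerDr !scalerA mulr1 mulrC divfK.
have := par_map (pair_vec1_neq0 (x j 0 / x i 0)) (ex_intro2 _ _ (x i 0) xi erefl).
move=> p /(par_trans p) /sg_eq; rewrite pair_vec0 pair_vec1 => ->.
have -> : sg (x j 0) = sg (x j 0 / x i 0) * sg (x i 0) by rewrite -sgM divfK.
by rewrite mulrCA divfK.
Qed.

End Frame.
End Intertwine.

(** * Field endomorphisms commuting with conjugation *)

Section ComplexEndo.
Variable R : realType.
Local Notation C := R[i].

(** Nonnegative numbers are squares, so [f] is monotone; it fixes the rationals, which are dense. *)
Lemma real_endo_id (f : {rmorphism R -> R}) : f =1 id.
Proof.
have f_ge0 x : 0 <= x -> 0 <= f x.
  by move=> x0; rewrite -(sqr_sqrtr x0) rmorphXn sqr_ge0.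
have f_le x y : x <= y -> f x <= f y.
  by move=> xy; rewrite -subr_ge0 -rmorphB f_ge0 // subr_ge0.
move=> x; apply/eqP; rewrite eq_le; apply/andP; split; rewrite leNgt; apply/negP.
  move=> /rat_in_itvoo [q]; rewrite in_itv /= => /andP[xq qf].
  by have := f_le _ _ (ltW xq); rewrite fmorph_rat leNgt qf.
move=> /rat_in_itvoo [q]; rewrite in_itv /= => /andP[fq qx].
by have := f_le _ _ (ltW qx); rewrite fmorph_rat leNgt fq.
Qed.

(** Commuting with conjugation, [s] maps reals to reals and hence fixes them; the square of [s 'i]
    is -1. *)
Lemma complex_endo (s : C -> C) : s 1 = 1 -> {morph s : x y / x + y} ->
  {morph s : x y / x * y} -> (forall z : C, s (conjc z) = conjc (s z)) ->
  s =1 id \/ s =1 conjc.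
Proof.
move=> s1 sD sM sJ.
have s0 : s 0 = 0 by apply: (addrI (s 0)); rewrite -sD !addr0.
have sN x : s (- x) = - s x by apply/eqP; rewrite -addr_eq0 -sD addNr s0.
pose f (x : R) := Re (s x%:C%C).
have sf x : s x%:C%C = (f x)%:C%C.
  rewrite /f; have := sJ x%:C%C; rewrite conjc_real; case: (s _) => a b [] bE /=.
  by congr (_ +i* _)%C; lra.
have fB : zmod_morphism f.
  by move=> x y; apply: (@complexI R); rewrite -sf !rmorphB sD sN !sf.
have fM : monoid_morphism f.
  split=> [|x y]; apply: (@complexI R); first by rewrite -sf s1.
  by rewrite -sf !rmorphM sM !sf.
pose fz := GRing.isZmodMorphism.Build _ _ f fB.
pose fm := GRing.isMonoidMorphism.Build _ _ f fM.
pose F : {rmorphism R -> R} := HB.pack f fz fm.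
have fid x : f x = x by exact: (real_endo_id F x).
have E (z : C) : s z = (Re z)%:C%C + s 'i%C * (Im z)%:C%C.
  by rewrite {1}(complexE z) sD sM !sf !fid.
have : s 'i%C ^+ 2 = 'i%C ^+ 2.
  by rewrite expr2 -sM -expr2 sqr_i sN s1.
move/eqP; rewrite -subr_eq0 subr_sqr mulf_eq0 subr_eq0 addr_eq0 => /orP[]/eqP si.
  by left => z; rewrite E si -complexE.
right => z; rewrite E si; case: z => a b.
by apply/eqP; rewrite eq_complex /=; apply/andP; split; apply/eqP; ring.
Qed.

End ComplexEndo.

(** * Matrices determined by the zeros of their forms *)

Section Forms.
Variables (R : realType) (n : nat).
Local Notation C := R[i].
Implicit Types (x y z u v : 'cV[C]_n) (A B : 'M[C]_n).

(** Both matrices have the same kernel and proportional values at each vector. It remains to see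
    that the factor does not depend on the vector. *)
Lemma forms_par A B : (forall x y, ip y (A *m x) = 0 <-> ip y (B *m x) = 0) ->
  exists2 c, c != 0 & A = c *: B.
Proof.
move=> AB.
have ker x : B *m x = 0 <-> A *m x = 0.
  split=> e; apply/eqP; rewrite -ip_eq0; apply/eqP; apply: (AB _ _).2 || apply: (AB _ _).1;
  by rewrite e ip0r.
have par_im x : A *m x != 0 -> par (B *m x) (A *m x).
  move=> Ax0; apply: orth_par => // t /ip_eq0C /(AB x t).2; exact: (ip_eq0C _ _).2.
have im x : exists c, A *m x = c *: (B *m x).
  have [e|/par_im [c _ e]] := eqVneq (A *m x) 0; last by exists c.
  by exists 0; rewrite e scale0r.
have [B0|] := pselect (forall x, B *m x = 0).
  exists 1; first exact: oner_neq0.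
  by apply: mulmx_ext => x; rewrite scale1r B0; apply: (ker x).1.
move=> /existsNP [x0 /eqP Bx0].
have Ax0 : A *m x0 != 0 by apply: contra_neq Bx0 => /ker.
have [c c0 ec] := par_im x0 Ax0.
exists c => //; apply: mulmx_ext => x; rewrite -scalemxAl.
have [[b eb]|nb] := pselect (exists b, B *m x = b *: (B *m x0)).
  have : B *m (x - b *: x0) = 0 by rewrite mulmxBr -scalemxAr eb subrr.
  move=> /ker; rewrite mulmxBr -scalemxAr => /eqP; rewrite subr_eq0 => /eqP ->.
  by rewrite ec eb !scalerA mulrC.
(* Here [B *m x] and [B *m x0] are independent, so the factors at [x], [x0] and [x + x0] agree. *)
have [l el] := im x; have [m em] := im (x + x0).
move: em; rewrite !mulmxDr el ec scalerDr => em.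
have em' : (l - m) *: (B *m x) = (m - c) *: (B *m x0).
  apply/eqP; rewrite !scalerBl subr_eq addrAC -subr_eq opprK addrC; apply/eqP.
  by rewrite addrC em addrC.
have lm : l - m = 0.
  apply/eqP/negPn/negP => lm0; apply: nb; exists ((l - m)^-1 * (m - c)).
  by rewrite -scalerA -em' scalerA mulVf // scale1r.
have mc : m - c = 0.
  move: em'; rewrite lm scale0r => /esym/eqP; rewrite scaler_eq0 (negPf Bx0) orbF.
  by move/eqP.
by move/eqP: lm; move/eqP: mc; rewrite !subr_eq0 => /eqP <- /eqP ->.
Qed.

Lemma ip_map (s : {rmorphism C -> C}) x y : (forall z : C, s (conjc z) = conjc (s z)) ->
  ip (map_mx s x) (map_mx s y) = s (ip x y).
Proof.
move=> sJ; rewrite !ipE rmorph_sum; apply: eq_bigr => k _.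
by rewrite !mxE rmorphM sJ.
Qed.

Variables (h : 'cV[C]_n -> 'cV[C]_n) (Q : 'M[C]_n -> 'M[C]_n).
Hypothesis h0 : forall x, x != 0 -> h x != 0.
Hypothesis h_surj : forall z, z != 0 -> exists2 x, x != 0 & par (h x) z.
Hypothesis hQ : forall B x y, x != 0 -> y != 0 ->
  ip y (B *m x) = 0 <-> ip (h y) (Q B *m h x) = 0.
Hypothesis h_orth : forall x y, x != 0 -> y != 0 -> ip y x = 0 <-> ip (h y) (h x) = 0.

Lemma intertwiner_of_morph (s : {rmorphism C -> C}) :
  (forall z : C, s (conjc z) = conjc (s z)) ->
  (forall x, x != 0 -> par (map_mx s x) (h x)) ->
  forall B, exists2 c, c != 0 & Q B = c *: map_mx s B.
Proof.
move=> sJ hs B; apply: forms_par => x y.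
have [->|x0] := eqVneq x 0; first by rewrite !mulmx0.
have [->|y0] := eqVneq y 0; first by rewrite !ip0l.
have [u u0 [a a0 ->]] := h_surj x0; have [v v0 [b b0 ->]] := h_surj y0.
have scale (D : 'M[C]_n) (w z : 'cV[C]_n) (p q : C) : p != 0 -> q != 0 ->
    ip (p *: w) (D *m (q *: z)) = 0 <-> ip w (D *m z) = 0.
  move=> p0 q0; rewrite -scalemxAr ipZl ipZr; split=> [/eqP|->]; last by rewrite !mulr0.
  by rewrite !mulf_eq0 conjc_eq0 (negPf p0) (negPf q0) /= => /eqP.
rewrite !scale // -hQ //.
have [c c0 ->] := hs u u0; have [d d0 ->] := hs v v0; rewrite scale //.
rewrite -map_mxM (ip_map _ _ sJ); split=> [->|/eqP]; first by rewrite rmorph0.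
by rewrite fmorph_eq0 => /eqP.
Qed.

Hypothesis n2 : (1 < n)%N.
Hypothesis he : forall k, par (h (delta_mx k 0)) (delta_mx k 0).
Hypothesis hone : par (h (const_mx 1)) (const_mx 1).

Lemma intertwiner_form : exists2 s : {rmorphism C -> C}, (s =1 id \/ s =1 conjc) &
  forall B, exists2 c, c != 0 & Q B = c *: map_mx s B.
Proof.
pose i0 := Ordinal (ltnW n2); pose i1 := Ordinal n2.
have i01 : i0 != i1 by [].
pose s := sg h i0 i1.
have sM : {morph s : x y / x * y}.
  by move=> x y; exact: (sgM h0 h_surj hQ h_orth he hone i01).
have sD : {morph s : x y / x + y}.
  by move=> x y; exact: (sgD h0 h_surj hQ h_orth he hone i01).
have s1 : s 1 = 1 by exact: (sg1 h_orth he hone i01).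
have sJ : forall z : C, s (conjc z) = conjc (s z).
  by move=> z; exact: (sg_conj h0 h_surj hQ h_orth he hone i01).
have hs x : x != 0 -> par (map_mx s x) (h x).
  by move=> x0; exact: (h_sg h0 h_surj hQ h_orth he hone i01).
have [sid|sc] := complex_endo s1 sD sM sJ.
  exists (idfun : {rmorphism C -> C}); first by left.
  apply: intertwiner_of_morph => // x x0.
  by rewrite (_ : map_mx _ x = map_mx s x); [exact: hs|apply: eq_map_mx => z; rewrite sid].
exists (conjc : {rmorphism C -> C}); first by right.
apply: intertwiner_of_morph => // x x0.
by rewrite (_ : map_mx _ x = map_mx s x); [exact: hs|apply: eq_map_mx => z; rewrite sc].
Qed.

End Forms.

(** * Multiples of unitary matrices *)

Section Conformal.
Variables (R : realType) (n : nat).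
Hypothesis n0 : (0 < n)%N.
Local Notation C := R[i].
Implicit Types (A B : 'M[C]_n) (x y : 'cV[C]_n).

Lemma opnorm_conformal A k : (forall x, sq (A *m x) = k * sq x) -> opnorm A ^+ 2 = k.
Proof.
move=> h; have [x x0 xA] := opnorm_attained n0 A.
have sx : sq x != 0 by rewrite sq_eq0.
by apply: (mulIf sx); rewrite -h; apply: esym.
Qed.

Lemma conformal_attains A k : (forall x, sq (A *m x) = k * sq x) -> forall x, attains A x.
Proof. by move=> h x; rewrite /attains (opnorm_conformal h). Qed.

Lemma ctr_mul_attains A : (forall x, attains A x) -> ctr A *m A = (opnorm A ^+ 2)%:C%C%:M.
Proof.
move=> hA; apply: mulmx_ext => x; apply: ip_ext => z.
by rewrite -mulmxA -ip_ctr (attains_ip n0 _ (hA z)) mul_scalar_mx ipZr.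
Qed.

Lemma mul_ctrC A (c : C) : c != 0 -> ctr A *m A = c%:M -> A *m ctr A = c%:M.
Proof.
move=> c0 h; have : (c^-1 *: ctr A) *m A = 1%:M.
  by rewrite -scalemxAl h scale_scalar_mx mulVf.
move=> /mulmx1C; rewrite -scalemxAr => e.
by rewrite -[LHS](scalerKV c0) e scale_scalar_mx mulr1.
Qed.

Lemma sq_ctr_mul A (k : R) x : A *m ctr A = k%:C%C%:M -> sq (ctr A *m x) = k * sq x.
Proof.
move=> h; apply: (@complexI R); rewrite -ip_sq ip_ctrr mulmxA h mul_scalar_mx ipZr ip_sq.
by rewrite rmorphM.
Qed.

End Conformal.

(** * Reduction to a ray map *)

Section Product.
Variables (R : realType) (n : nat).
Hypothesis n2 : (1 < n)%N.
Local Notation C := R[i].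
Local Notation V := 'cV[C]_n.
Variables (Phi Psi : 'M[C]_n -> 'M[C]_n).
Hypotheses (PhiK : cancel Phi Psi) (PsiK : cancel Psi Phi).
Hypothesis BJ : forall A B, BJorth A B <-> BJorth (Phi A) (Phi B).
Variables f g : V -> V.
Hypothesis fg : forall x y, x != 0 -> y != 0 -> [/\ f x != 0, g y != 0 &
  exists2 c, c != 0 & Phi (rk1 y x) = c *: rk1 (g y) (f x)].
Implicit Types (x y z u v : V) (A B : 'M[C]_n).
Local Notation e k := (delta_mx k 0 : V).
Local Notation one := (const_mx 1 : V).

Let n0 : (0 < n)%N := ltnW n2.

Lemma f_neq0 x : x != 0 -> f x != 0.
Proof. by move=> x0; have [] := fg x0 x0. Qed.

Lemma g_neq0 x : x != 0 -> g x != 0.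
Proof. by move=> x0; have [] := fg x0 x0. Qed.

Lemma Phi_rk1 x y : x != 0 -> y != 0 ->
  exists2 c, c != 0 & Phi (rk1 y x) = rk1 (c *: g y) (f x).
Proof. by move=> x0 y0; have [_ _ [c c0 ->]] := fg x0 y0; exists c; rewrite ?rk1Zl. Qed.

Lemma cg_neq0 (c : C) y : c != 0 -> y != 0 -> c *: g y != 0.
Proof. by move=> c0 y0; rewrite scaler_eq0 negb_or c0 g_neq0. Qed.

(** The preimage of [rk1 z z] under [Phi] is some [rk1 y x], and then [f x] is parallel to [z]. *)
Lemma f_surj z : z != 0 -> exists2 x, x != 0 & par (f x) z.
Proof.
move=> z0; have BJ' := BJ_inv PsiK BJ.
have rz : isrk1 (rk1 z z) by exists z, z.
have [y [x [y0 x0 e]]] := @isrk1_iso R n n0 Psi Phi PsiK PhiK BJ' _ rz.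
have [c c0] := Phi_rk1 x0 y0; rewrite -e PsiK => ez.
exists x => //; apply: par_sym.
have := (rk1_sub n0 z0 z0 (f_neq0 x0) (cg_neq0 c0 y0)).1.
by rewrite -ez => -[] // D.
Qed.

Lemma zero_form B x y : x != 0 -> y != 0 ->
  ip y (B *m x) = 0 <-> ip (g y) (Phi B *m f x) = 0.
Proof.
move=> x0 y0; have [c c0 e] := Phi_rk1 x0 y0.
have h1 := BJorth_rk1 n0 B x0 y0.
have h2 := BJorth_rk1 n0 (Phi B) (f_neq0 x0) (cg_neq0 c0 y0).
have h3 := BJ (rk1 y x) B; rewrite e in h3.
have h4 : ip (c *: g y) (Phi B *m f x) = 0 <-> ip (g y) (Phi B *m f x) = 0.
  by apply: iff_sym; apply: par_ip_eq0; exists c.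
by split=> h; [exact: h4.1 (h2.1 (h3.1 (h1.2 h)))|exact: h1.1 (h3.2 (h2.2 (h4.2 h)))].
Qed.

(** That [x] is norming for [A] means [BJsub (rk1 (A *m x) x) A], a relation which [Phi]
    preserves. *)
Lemma norming_pair A x : A != 0 -> x != 0 -> attains A x ->
  attains (Phi A) (f x) /\ exists2 c, c != 0 & g (A *m x) = c *: (Phi A *m f x).
Proof.
move=> A0 x0 xA; have y0 := attains_mul_neq0 n0 A0 x0 xA.
have PA0 : Phi A != 0 by apply/eqP => /(Phi_eq0 n0 BJ) /eqP; apply/negP.
have [c c0 e] := Phi_rk1 x0 y0.
have s1 : BJsub (rk1 (A *m x) x) A.
  by apply: (rk1_BJorth_sub n0 A0 x0 y0).2; split; [exact: xA|exists 1; rewrite scale1r].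
have := (@BJsub_iso R n Phi Psi PsiK BJ _ _).1 s1; rewrite e => s2.
have [xPA [d ed]] := (rk1_BJorth_sub n0 PA0 (f_neq0 x0) (cg_neq0 c0 y0)).1 s2.
have [d0 _] := neq0_scaler (cg_neq0 c0 y0) ed.
split; first exact: xPA.
exists (c^-1 * d); first by rewrite mulf_neq0 ?invr_eq0.
by rewrite -scalerA -ed scalerA mulVf // scale1r.
Qed.

Lemma Phi_conformal A : A != 0 -> (forall x, attains A x) -> forall z, attains (Phi A) z.
Proof.
move=> A0 hA z; have [->|z0] := eqVneq z 0.
  by rewrite /attains mulmx0 /sq ip0r mulr0.
have [x x0 [c c0 ->]] := f_surj z0; apply: attainsZ.
by have [] := norming_pair A0 x0 (hA x).
Qed.

Let W := Phi 1%:M.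
Let w : R := opnorm W ^+ 2.

Lemma scalar1_neq0 : 1%:M != 0 :> 'M[C]_n.
Proof.
apply/eqP => /matrixP /(_ (Ordinal n0) (Ordinal n0)) /eqP.
by rewrite !mxE eqxx oner_eq0.
Qed.

Lemma attains1 x : attains (1%:M : 'M[C]_n) x.
Proof. by apply: (conformal_attains n0 (k := 1)) => y; rewrite mul1mx mul1r. Qed.

Lemma W_attains z : attains W z.
Proof. exact: Phi_conformal scalar1_neq0 attains1 z. Qed.

Lemma w_gt0 : 0 < w.
Proof.
rewrite exprn_even_gt0 //= opnorm_eq0 //.
by apply/eqP => /(Phi_eq0 n0 BJ) /eqP; apply/negP; exact: scalar1_neq0.
Qed.

Lemma wC_neq0 : w%:C%C != 0 :> C.
Proof. by rewrite (inj_eq (@complexI R)) gt_eqF ?w_gt0. Qed.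

Lemma ctrW_W : ctr W *m W = w%:C%C%:M.
Proof. by rewrite (ctr_mul_attains n0 W_attains). Qed.

Lemma W_ctrW : W *m ctr W = w%:C%C%:M.
Proof. exact: mul_ctrC wC_neq0 ctrW_W. Qed.

Let Q0 B := ctr W *m Phi B.

(** Since [g y] is proportional to [W *m f y], composing with [ctr W] leaves a single ray map [f] on
    both sides. *)
Lemma Q0_form B x y : x != 0 -> y != 0 ->
  ip y (B *m x) = 0 <-> ip (f y) (Q0 B *m f x) = 0.
Proof.
move=> x0 y0; have [_ [c c0]] := norming_pair scalar1_neq0 y0 (attains1 y).
rewrite mul1mx => e; apply: iff_trans (zero_form B x0 y0) _.
rewrite e -mulmxA -ip_ctr; apply: iff_sym; apply: par_ip_eq0.
by exists c.
Qed.

Lemma f_orth x y : x != 0 -> y != 0 -> ip y x = 0 <-> ip (f y) (f x) = 0.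
Proof.
move=> x0 y0; have := Q0_form 1%:M x0 y0; rewrite mul1mx /Q0 -/W ctrW_W mul_scalar_mx ipZr.
move=> h; apply: iff_trans h _; split=> [/eqP|->]; last by rewrite mulr0.
by rewrite mulf_eq0 (negPf wC_neq0) => /eqP.
Qed.

Lemma one_neq0 : one != 0.
Proof. by apply/eqP => /matrixP /(_ (Ordinal n0) 0) /eqP; rewrite !mxE oner_eq0. Qed.

(** The orthogonal projection of [f one] onto the ray of [f (e k)]. *)
Let t k : V := (ip (f (e k)) (f one) / ip (f (e k)) (f (e k))) *: f (e k).

Lemma t_par k : par (f (e k)) (t k).
Proof.
exists (ip (f (e k)) (f one) / ip (f (e k)) (f (e k))) => //.
rewrite mulf_neq0 ?invr_eq0 ?ip_eq0 ?f_neq0 ?delta_neq0 //.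
apply/eqP => /(f_orth one_neq0 (delta_neq0 _ k)).2 /eqP.
by rewrite ip_delta mxE oner_eq0.
Qed.

Lemma t_neq0 k : t k != 0.
Proof.
have [a a0 ->] := t_par k; rewrite scaler_eq0 negb_or a0.
by rewrite f_neq0 // delta_neq0.
Qed.

Lemma t_orth k l : k != l -> ip (t k) (t l) = 0.
Proof.
move=> kl; have h : ip (f (e k)) (f (e l)) = 0.
  by apply: (f_orth (delta_neq0 _ l) (delta_neq0 _ k)).1; rewrite ip_delta mxE (negPf kl).
by rewrite ipZl ipZr h !mulr0.
Qed.

Lemma ip_sumr x (v : 'I_n -> V) : ip x (\sum_k v k) = \sum_k ip x (v k).
Proof. by rewrite /ip mulmx_sumr summxE. Qed.

(** The difference is orthogonal to all [f (e k)]. If nonzero, it would be a multiple of some [f x]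
    with [x] orthogonal to all [e k]. *)
Lemma f_one : f one = \sum_k t k.
Proof.
apply/eqP; rewrite -subr_eq0; apply/negPn/negP => d0.
have fed k : ip (f (e k)) (f one - \sum_k t k) = 0.
  rewrite ipBr ip_sumr (bigD1 k) //= big1 => [|l lk].
    rewrite addr0 ipZr divfK ?subrr // ip_eq0 f_neq0 // delta_neq0 //.
  apply: (par_ip_eq0 _ (t_par k)).2; apply: t_orth; by rewrite eq_sym.
have [x x0 [a a0 ex]] := f_surj d0.
suff xz : x = 0 by rewrite xz eqxx in x0.
apply/matrixP => k l; rewrite ord1 mxE -ip_delta.
apply: (f_orth x0 (delta_neq0 _ k)).2; have /eqP := fed k.
by rewrite ex ipZr mulf_eq0 (negPf a0) => /eqP.
Qed.

(** The transposition matrix [P] fixes [one] and swaps [e i] with [e j]. So the conformal matrix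
    [Q0 P] maps [f one] to a multiple [l] of itself and [t j] to a multiple [b] of [t i]. Comparing
    components along [t i] gives [l = b], and both have the modulus by which [Q0 P] scales
    lengths. *)
Lemma t_norm_eq i j : sq (t i) = sq (t j).
Proof.
have [->//|ij] := eqVneq i j.
pose P : 'M[C]_n := perm_mx (tperm i j).
have PE x k : (P *m x) k 0 = x (tperm i j k) 0 by rewrite -row_permE mxE.
have Psq x : sq (P *m x) = 1 * sq x.
  rewrite mul1r !sqE (reindex_inj (@perm_inj _ (tperm i j))) /=.
  by apply: eq_bigr => k _; rewrite PE tpermK.
have PA := conformal_attains n0 Psq.
have P0 : P != 0.
  by apply/eqP => P0; have := opnorm_conformal n0 Psq; rewrite P0 => /eqP;
     rewrite (eqP (_ : opnorm 0 == 0)) ?opnorm_eq0 // expr0n eq_sym oner_eq0.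
have QPA : exists k, forall z, sq (Q0 P *m z) = k * sq z.
  exists (w * opnorm (Phi P) ^+ 2) => z.
  by rewrite -mulmxA (sq_ctr_mul _ W_ctrW) (Phi_conformal P0 PA z) mulrA.
have {QPA} [k Qk] := QPA.
have Pone : P *m one = one by apply/matrixP => a b; rewrite ord1 PE !mxE.
have Pel l : exists2 b, b != 0 & Q0 P *m t l = b *: t (tperm i j l).
  have Pel : P *m e l = e (tperm i j l).
    apply/matrixP => a b; rewrite ord1 PE !mxE.
    by rewrite (can2_eq (tpermK i j) (tpermK i j)).
  have := @intertwine _ _ _ _ f_surj Q0_form f_orth P (e l).
  rewrite Pel => /(_ (delta_neq0 _ _)) p.
  have [a a0 ->] := t_par l; rewrite -scalemxAr.
  have [b b0 ->] := par_trans (par_sym (t_par (tperm i j l))) p.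
  by exists (a * b); rewrite ?mulf_neq0 // scalerA.
have [l l0 fl] : par (f one) (Q0 P *m f one).
  by have := @intertwine _ _ _ _ f_surj Q0_form f_orth P one; rewrite Pone => /(_ one_neq0).
have [b b0 eb] := Pel j; rewrite tpermR in eb.
have lb : l = b.
  have : ip (t i) (Q0 P *m f one) = ip (t i) (Q0 P *m t j).
    rewrite f_one mulmx_sumr ip_sumr (bigD1 j) //= big1 ?addr0 // => m mj.
    have [c _ ->] := Pel m; rewrite ipZr t_orth ?mulr0 //.
    by apply: contra_neq mj => im; apply: (@perm_inj _ (tperm i j)); rewrite tpermR.
  rewrite fl ipZr eb ipZr f_one ip_sumr (bigD1 i) //= big1 => [|m mi]; last first.
    by apply: t_orth; rewrite eq_sym.
  by rewrite addr0 => /mulIf -> //; rewrite ip_eq0 t_neq0.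
have kl : k = nsq l.
  have : sq (f one) != 0 by rewrite sq_eq0 f_neq0 // one_neq0.
  by move=> h; apply: (mulIf h); rewrite -Qk fl sqZ.
have := Qk (t j); rewrite eb sqZ kl lb => h.
by apply: (mulfI _ h); rewrite nsq_eq0.
Qed.

(** A multiple of a unitary matrix, as the [t k] are orthogonal of equal norm. Undoing it turns [f]
    into a ray map fixing the rays of all [e k] and of [one]. *)
Let T : 'M[C]_n := \sum_k rk1 (t k) (e k).
Let tau := sq (t (Ordinal n0)).

Lemma T_mul x : T *m x = \sum_k x k 0 *: t k.
Proof. by rewrite mulmx_suml; apply: eq_bigr => k _; rewrite rk1_mul ip_delta. Qed.

Lemma ip_suml x (v : 'I_n -> V) : ip (\sum_k v k) x = \sum_k ip (v k) x.
Proof. by rewrite ipC ip_sumr rmorph_sum; apply: eq_bigr => k _; rewrite [RHS]ipC. Qed.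

Lemma ip_T x y : ip (T *m x) (T *m y) = tau%:C%C * ip x y.
Proof.
rewrite !T_mul ip_suml ipE mulr_sumr; apply: eq_bigr => k _.
rewrite ip_sumr (bigD1 k) //= big1 => [|l lk].
  by rewrite addr0 ipZl ipZr ip_sq (t_norm_eq k (Ordinal n0)) -/tau; ring.
by rewrite ipZl ipZr t_orth ?mulr0 // eq_sym.
Qed.

Lemma tau_gt0 : 0 < tau. Proof. by rewrite sq_gt0 t_neq0. Qed.

Lemma tauC_neq0 : tau%:C%C != 0 :> C.
Proof. by rewrite (inj_eq (@complexI R)) gt_eqF ?tau_gt0. Qed.

Lemma ctrT_T : ctr T *m T = tau%:C%C%:M.
Proof.
apply: mulmx_ext => x; apply: ip_ext => z.
by rewrite -mulmxA -ip_ctr ip_T mul_scalar_mx ipZr.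
Qed.

Lemma T_ctrT : T *m ctr T = tau%:C%C%:M.
Proof. exact: mul_ctrC tauC_neq0 ctrT_T. Qed.

Lemma T_delta k : T *m e k = t k.
Proof.
rewrite T_mul (bigD1 k) //= big1 => [|l lk]; rewrite !mxE.
  by rewrite !eqxx scale1r addr0.
by rewrite (negPf lk) scale0r.
Qed.

Lemma T_one : T *m one = f one.
Proof. by rewrite T_mul f_one; apply: eq_bigr => k _; rewrite mxE scale1r. Qed.

Let h x := ctr T *m f x.
Let Q B := ctr T *m Q0 B *m T.

Lemma T_h x : T *m h x = tau%:C%C *: f x.
Proof. by rewrite mulmxA T_ctrT mul_scalar_mx. Qed.

Lemma h_neq0 x : x != 0 -> h x != 0.
Proof.
move=> x0; apply/eqP => hx; have := T_h x; rewrite hx mulmx0 => /esym/eqP.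
by rewrite scaler_eq0 (negPf tauC_neq0) (negPf (f_neq0 x0)).
Qed.

Lemma h_surj z : z != 0 -> exists2 x, x != 0 & par (h x) z.
Proof.
move=> z0; have Tz0 : T *m z != 0.
  apply/eqP => Tz; have := congr1 (fun v => ctr T *m v) Tz.
  rewrite mulmxA ctrT_T mul_scalar_mx mulmx0 => /eqP.
  by rewrite scaler_eq0 (negPf tauC_neq0) (negPf z0).
have [x x0 [a a0 ex]] := f_surj Tz0; exists x => //.
apply: (par_scale (a := tau%:C%C^-1 * a)) => //.
rewrite -scalerA /h scalemxAr -ex mulmxA ctrT_T mul_scalar_mx scalerA mulVf ?scale1r //.
exact: tauC_neq0.
Qed.

Lemma h_form B x y : x != 0 -> y != 0 ->
  ip y (B *m x) = 0 <-> ip (h y) (Q B *m h x) = 0.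
Proof.
move=> x0 y0; apply: iff_trans (Q0_form B x0 y0) _.
have -> : ip (h y) (Q B *m h x) = tau%:C%C * tau%:C%C * ip (f y) (Q0 B *m f x).
  by rewrite /Q -!mulmxA -ip_ctr !T_h -!scalemxAr ipZl ipZr conjc_real mulrA.
split=> [->|/eqP]; first by rewrite mulr0.
by rewrite !mulf_eq0 (negPf tauC_neq0) => /eqP.
Qed.

Lemma h_orth x y : x != 0 -> y != 0 -> ip y x = 0 <-> ip (h y) (h x) = 0.
Proof.
move=> x0 y0; apply: iff_trans (f_orth x0 y0) _.
have -> : ip (h y) (h x) = tau%:C%C * ip (f y) (f x).
  by rewrite ip_ctrr T_h ipZr.
split=> [->|/eqP]; first by rewrite mulr0.
by rewrite mulf_eq0 (negPf tauC_neq0) => /eqP.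
Qed.

Lemma h_T x z : par (f x) (T *m z) -> par (h x) z.
Proof.
move=> [a a0 ex]; apply: (par_trans (y := tau%:C%C *: z)); last first.
  by apply: par_sym; exists tau%:C%C; rewrite ?tauC_neq0.
by exists a => //; rewrite /h scalemxAr -ex mulmxA ctrT_T mul_scalar_mx.
Qed.

Lemma h_delta k : par (h (e k)) (e k).
Proof. by apply: h_T; rewrite T_delta; exact: t_par. Qed.

Lemma h_one : par (h one) one.
Proof. by apply: h_T; rewrite T_one; exact: par_refl. Qed.

Lemma conformal_form : exists (U1 V1 : 'M[C]_n) (p q : R) (s : {rmorphism C -> C}),
  [/\ 0 < p, 0 < q, forall x, sq (U1 *m x) = p * sq x,
    forall x, sq (V1 *m x) = q * sq x &
    (s =1 id \/ s =1 conjc) /\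
    forall B, exists2 c, c != 0 & c *: Phi B = U1 *m map_mx s B *m V1].
Proof.
have [s sE sQ] := intertwiner_form h_neq0 h_surj h_form h_orth n2 h_delta h_one.
exists (W *m T), (ctr T), (w * tau), tau, s; split.
- by rewrite mulr_gt0 ?w_gt0 ?tau_gt0.
- exact: tau_gt0.
- move=> x; rewrite -mulmxA (W_attains (T *m x)) -/w -mulrA; congr (_ * _).
  by apply: (@complexI R); rewrite -ip_sq ip_T ip_sq rmorphM.
- by move=> x; rewrite (sq_ctr_mul _ T_ctrT).
split=> // B; have [c c0 eQ] := sQ B.
(* The factors come from [W *m ctr W], which gives [w], and from two products [T *m ctr T], each
   giving [tau]. *)
exists (c^-1 * (w%:C%C * (tau%:C%C * tau%:C%C))).
  by rewrite !mulf_neq0 ?invr_eq0 ?wC_neq0 ?tauC_neq0.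
have -> : map_mx s B = c^-1 *: Q B by rewrite eQ scalerA mulVf // scale1r.
rewrite -scalemxAr -scalemxAl -scalerA; congr (_ *: _).
have -> : W *m T *m Q B *m ctr T =
   W *m ((T *m ctr T) *m (ctr W *m Phi B) *m (T *m ctr T)) by rewrite /Q /Q0 !mulmxA.
rewrite T_ctrT mul_scalar_mx mul_mx_scalar scalerA -scalemxAr mulmxA W_ctrW.
by rewrite mul_scalar_mx scalerA mulrC.
Qed.

End Product.

(** * Unitary normal form *)

Section Conclusion.
Variables (R : realType) (n : nat).
Hypothesis n2 : (1 < n)%N.
Local Notation C := R[i].
Implicit Types (A B X Y : 'M[C]_n) (x y z : 'cV[C]_n).

Let n0 : (0 < n)%N := ltnW n2.

Definition isometric A : Prop := forall x, sq (A *m x) = sq x.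

Lemma isometric_ctr A : isometric A -> isometric (ctr A) /\ A *m ctr A = 1%:M.
Proof.
move=> hA; have h x : sq (A *m x) = 1 * sq x by rewrite hA mul1r.
have e := ctr_mul_attains n0 (conformal_attains n0 h).
rewrite (opnorm_conformal n0 h) in e.
have e' : A *m ctr A = (1 : R)%:C%C%:M by apply: mul_ctrC e; exact: oner_neq0.
by split=> // x; rewrite (sq_ctr_mul x e') mul1r.
Qed.

Lemma opnorm_mull U A : isometric U -> opnorm (U *m A) = opnorm A.
Proof. by move=> hU; apply: (opnorm_eq n0) => x; rewrite -mulmxA hU. Qed.

Lemma opnorm_mulr_le A V : isometric V -> opnorm (A *m V) <= opnorm A.
Proof.
move=> hV; apply: (opnorm_le n0 (opnorm_ge0 n0 A)) => x.
by rewrite -mulmxA -(hV x); exact: sq_mul_le.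
Qed.

Lemma opnorm_mulr A V : isometric V -> opnorm (A *m V) = opnorm A.
Proof.
move=> hV; have [hV' e] := isometric_ctr hV; have h := opnorm_mulr_le (A *m V) hV'.
rewrite -mulmxA e mulmx1 in h.
exact: le_anti (introT andP (conj (opnorm_mulr_le A hV) h)).
Qed.

Lemma sq_map_conj x : sq (map_mx conjc x) = sq x.
Proof.
rewrite !sqE; apply: eq_bigr => k _; rewrite mxE.
by case: (x k 0) => a b /=; rewrite sqrrN.
Qed.

Lemma map_conjK m (A : 'M[C]_(n, m)) : map_mx conjc (map_mx conjc A) = A.
Proof. by apply/matrixP => i j; rewrite !mxE conjcK. Qed.

Lemma opnorm_map_conj_le A : opnorm (map_mx conjc A) <= opnorm A.
Proof.
apply: (opnorm_le n0 (opnorm_ge0 n0 A)) => x.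
rewrite -{1}(map_conjK x) -map_mxM sq_map_conj -(sq_map_conj x).
exact: sq_mul_le.
Qed.

Lemma opnorm_map_conj A : opnorm (map_mx conjc A) = opnorm A.
Proof.
have h := opnorm_map_conj_le (map_mx conjc A); rewrite map_conjK in h.
exact: le_anti (introT andP (conj (opnorm_map_conj_le A) h)).
Qed.

(** Cauchy-Schwarz bounds the square of [sq (ctr A *m x) = ip x (A *m (ctr A *m x))], and one factor
    [sq (ctr A *m x)] cancels. *)
Lemma opnorm_ctr_le A : opnorm (ctr A) <= opnorm A.
Proof.
apply: (opnorm_le n0 (opnorm_ge0 n0 A)) => x.
have [->|y0] := eqVneq (ctr A *m x) 0.
  by rewrite {1}/sq ip0r mulr_ge0 ?sqr_ge0 ?sq_ge0.
have sy : 0 < sq (ctr A *m x) by rewrite sq_gt0.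
have yE : nsq (ip x (A *m (ctr A *m x))) = sq (ctr A *m x) * sq (ctr A *m x).
  by rewrite -ip_ctrr ip_sq nsq_real expr2.
have cs := nsq_ip_le x (A *m (ctr A *m x)); rewrite yE in cs.
rewrite -(ler_pM2r sy); apply: (le_trans cs); rewrite -mulrA [X in _ <= X]mulrCA.
by apply: (ler_wpM2l (sq_ge0 x)); exact: sq_mul_le.
Qed.

Lemma opnorm_ctr A : opnorm (ctr A) = opnorm A.
Proof.
have h := opnorm_ctr_le (ctr A); rewrite ctrK in h.
exact: le_anti (introT andP (conj (opnorm_ctr_le A) h)).
Qed.

Lemma BJorth_ctr_imp A B : BJorth A B -> BJorth (ctr A) (ctr B).
Proof.
move=> h l; rewrite opnorm_ctr -[l]conjcK -ctrZ -ctrD opnorm_ctr.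
exact: h.
Qed.

Lemma BJorth_ctr A B : BJorth A B <-> BJorth (ctr A) (ctr B).
Proof.
split=> h; first exact: BJorth_ctr_imp h.
by have := BJorth_ctr_imp h; rewrite !ctrK.
Qed.

Definition scaled_isometry (Phi : 'M[C]_n -> 'M[C]_n) : Prop :=
  exists gamma : 'M[C]_n -> C,
    (forall X, gamma X != 0) /\
    ((is_linear (fun X => gamma X *: Phi X) \/
      is_conjlinear (fun X => gamma X *: Phi X)) /\
     is_isometry (fun X => gamma X *: Phi X)).

(** The conjugate transpose preserves the norm and exchanges linear with conjugate-linear maps. *)
Lemma scaled_isometry_ctr (Phi : 'M[C]_n -> 'M[C]_n) :
  scaled_isometry (fun X => ctr (Phi X)) -> scaled_isometry Phi.
Proof.
move=> [c [c0 [cl ci]]]; exists (fun X => conjc (c X)); split.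
  by move=> X; rewrite conjc_eq0.
have E X : conjc (c X) *: Phi X = ctr (c X *: ctr (Phi X)) by rewrite ctrZ ctrK.
split; last by move=> X Y; rewrite !E -scaleN1r -(rmorphN1 (@conjc R)) -ctrZ -ctrD
  opnorm_ctr scaleN1r ci.
by case: cl => cl; [right|left] => a X Y; rewrite !E cl ctrD ctrZ ?conjcK.
Qed.

Lemma isometric_normalize A (p : R) : 0 < p ->
  (forall x, sq (A *m x) = p * sq x) -> isometric ((Num.sqrt p)^-1%:C%C *: A).
Proof.
move=> p0 hA x; rewrite -scalemxAl sqZ nsq_real hA exprVn sqr_sqrtr ?ltW // mulKf //.
by rewrite gt_eqF.
Qed.

Lemma scaled_isometry_rk1 (Phi Psi : 'M[C]_n -> 'M[C]_n) (f g : 'cV[C]_n -> 'cV[C]_n) :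
  cancel Phi Psi -> cancel Psi Phi ->
  (forall A B, BJorth A B <-> BJorth (Phi A) (Phi B)) ->
  (forall x y, x != 0 -> y != 0 -> [/\ f x != 0, g y != 0 &
    exists2 c, c != 0 & Phi (rk1 y x) = c *: rk1 (g y) (f x)]) ->
  scaled_isometry Phi.
Proof.
move=> PhiK PsiK BJ fg.
have [U1 [V1 [p [q [s [p0 q0 hU hV [hs hPhi]]]]]]] := conformal_form n2 PhiK PsiK BJ fg.
have := isometric_normalize p0 hU; set u := (Num.sqrt p)^-1%:C%C; set U := u *: U1 => isoU.
have := isometric_normalize q0 hV; set v := (Num.sqrt q)^-1%:C%C; set V := v *: V1 => isoV.
have nz (r : R) : 0 < r -> (Num.sqrt r)^-1%:C%C != 0 :> C.
  by move=> r0; rewrite (inj_eq (@complexI R)) invr_eq0 gt_eqF // sqrtr_gt0.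
have H X : exists c, c != 0 /\ c *: Phi X = U *m map_mx s X *m V.
  have [c c0 e] := hPhi X; exists (u * (v * c)).
  split; first by rewrite !mulf_neq0 ?nz.
  by rewrite /U /V -!scalemxAl -scalemxAr -e !scalerA mulrA.
clearbody U V; have [c hc] := choice H.
have cE X : c X *: Phi X = U *m map_mx s X *m V by have [] := hc X.
exists c; split; first by move=> X; have [] := hc X.
have lin a X Y : c (a *: X + Y) *: Phi (a *: X + Y) = s a *: (c X *: Phi X) + c Y *: Phi Y.
  by rewrite !cE map_mxD map_mxZ mulmxDr mulmxDl -scalemxAr -scalemxAl.
split.
  by case: hs => hs; [left|right] => a X Y; rewrite lin hs.
move=> X Y; rewrite !cE -mulmxBl -mulmxBr -map_mxB (opnorm_mulr _ isoV) (opnorm_mull _ isoU).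
case: hs => hs; last by rewrite (eq_map_mx _ hs) opnorm_map_conj.
by rewrite (eq_map_mx _ hs) map_mx_id.
Qed.

Lemma BJiso_scaled_isometry (Phi : 'M[C]_n -> 'M[C]_n) : BJiso Phi -> scaled_isometry Phi.
Proof.
move=> [[Psi PhiK PsiK] BJ].
have [[f [g fg]]|[f [g fg]]] := rk1_map_split n2 PhiK PsiK BJ.
  exact: scaled_isometry_rk1 PhiK PsiK BJ fg.
(* When rows and columns are exchanged, [X] is sent to [ctr (Phi X)] instead, which is again an
   isomorphism and exchanges them back. *)
apply: scaled_isometry_ctr.
have aK : cancel (fun X => ctr (Phi X)) (fun X => Psi (ctr X)).
  by move=> X; rewrite ctrK PhiK.
have aK' : cancel (fun X => Psi (ctr X)) (fun X => ctr (Phi X)).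
  by move=> X; rewrite PsiK ctrK.
have aBJ A B : BJorth A B <-> BJorth (ctr (Phi A)) (ctr (Phi B)).
  exact: iff_trans (BJ A B) (BJorth_ctr _ _).
apply: (scaled_isometry_rk1 (f := f) (g := g) aK aK' aBJ) => x y x0 y0.
have [fx gy [c c0 e]] := fg x y x0 y0; split=> //.
by exists (conjc c); rewrite ?conjc_eq0 // e ctrZ ctr_rk1.
Qed.

End Conclusion.

Theorem theorem1p2 (R : realType) (n : nat) (hn : (2 <= n)%N)
    (Phi : 'M[R[i]]_n -> 'M[R[i]]_n) :
  BJiso Phi ->
  exists gamma : 'M[R[i]]_n -> R[i],
    (forall X, gamma X != 0) /\
    ((is_linear (fun X => gamma X *: Phi X) \/
      is_conjlinear (fun X => gamma X *: Phi X)) /\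
     is_isometry (fun X => gamma X *: Phi X)).
Proof. by move=> iso; exact: (@BJiso_scaled_isometry R n hn Phi iso). Qed.
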